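(* Let $p\in\mathbb Z_{>0}$ be even and $r\in\mathbb C$. Then $$u_{p,r}^{(n)}:=(\mathcal G^{tw})^n\,v_{p,r-n},\qquad n\in\mathbb Z_{>0},$$ is a family of singular vectors in $V[p,r]\cong\mathcal F_{p,r}$.
   Context: The $N=1$ Heisenberg-Virasoro algebra $\mathcal{SH}$ is the complex Lie superalgebra with even basis elements $L(n),\alpha(n)$ ($n\in\mathbb Z$), odd basis elements $G(n+\frac12),\Psi(n+\frac12)$ ($n\in\mathbb Z$), and even central elements $C_L,C_\alpha,C_{L,\alpha}$, with (super)commutators, for $m,n\in\mathbb Z$: $[\alpha(m),\alpha(n)]=\delta_{m+n,0}\,m\,C_\alpha$; $[L(m),\alpha(n)]=-n\,\alpha(m+n)-\delta_{m+n,0}(m^2+m)C_{L,\alpha}$; $[L(m),L(n)]=(m-n)L(m+n)+\delta_{m+n,0}\frac{m^3-m}{12}C_L$; $[\Psi(m+\frac12),\Psi(n+\frac12)]_+=\delta_{m+n+1,0}C_\alpha$; $[\alpha(m),\Psi(n+\frac12)]=0$; $[G(m+\frac12),G(n+\frac12)]_+=2L(m+n+1)+\delta_{m+n+1,0}\frac{m^2+m}{3}C_L$; $[L(m),G(n+\frac12)]=(\frac m2-n-\frac12)G(m+n+\frac12)$; $[\alpha(m),G(n+\frac12)]=m\,\Psi(m+n+\frac12)$; $[\Psi(m+\frac12),L(n)]=\frac{2m+n+1}{2}\Psi(m+n+\frac12)$; $[\Psi(m+\frac12),G(n+\frac12)]_+=\alpha(m+n+1)+2m\,\delta_{m+n+1,0}C_{L,\alpha}$.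 Let $\mathcal{SH}^{+}$ be the span of $L(n),\alpha(n),G(n-\frac12),\Psi(n-\frac12)$, $n\ge1$. A singular vector is a nonzero vector annihilated by $\mathcal{SH}^+$. Fix $c_L,c_{L,\alpha}\in\mathbb C$ with $c_{L,\alpha}\ne0$. For $p,r\in\mathbb C$ put $h_{p,r}=(1-p^2)\frac{c_L-3}{24}-rp$; $V[p,r]$ is the Verma $\mathcal{SH}$-module with highest weight vector $v$ satisfying $\mathcal{SH}^+v=0$, $L(0)v=h_{p,r}v$, $\alpha(0)v=(1+p)c_{L,\alpha}v$, on which $C_L,C_\alpha,C_{L,\alpha}$ act by $c_L,0,c_{L,\alpha}$. Free field realisation: let $M(1)$ be the rank two Heisenberg vertex algebra generated by $c(z),d(z)$ with $\langle c,c\rangle=\langle d,d\rangle=0$, $\langle c,d\rangle=2$, and $F^{(2)}$ the fermionic vertex superalgebra generated by odd fields $\Psi^\pm(z)=\sum_n\Psi^\pm(n+\frac12)z^{-n-1}$ with $\{\Psi^\pm(r),\Psi^\pm(s)\}=0$, $\{\Psi^+(r),\Psi^-(s)\}=\delta_{r+s,0}$. For $\gamma\in\mathbb Cc+\mathbb Cd$, $e^\gamma$ is the highest weight vector of the Heisenberg Fock module on which $c(0),d(0)$ act by $\langle c,\gamma\rangle,\langle d,\gamma\rangle$. Put $\overline d=d-\frac{c_L-3}{12}c$, $v_{p,r}=e^{-\frac{p+1}2\overline d+rc}$, $\mathcal F_{p,r}=(M(1)\otimes F^{(2)}).v_{p,r}$. $\mathcal{SH}$ acts on $\mathcal F_{p,r}$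 by $\alpha(n)=-c_{L,\alpha}c(n)$, $\Psi(s)=-\sqrt2c_{L,\alpha}\Psi^-(s)$, $\sum L(n)z^{-n-2}=Y(\omega,z)$, $\sum G(n+\frac12)z^{-n-2}=Y(\tau,z)$, where $\omega=\frac12c(-1)d(-1)+\frac{c_L-3}{24}c(-2)-\frac12d(-2)+\frac12\Psi^+(-\frac32)\Psi^-(-\frac12)+\frac12\Psi^-(-\frac32)\Psi^+(-\frac12)$, $\tau=\sqrt2(\frac12c(-1)\Psi^+(-\frac12)+\frac12d(-1)\Psi^-(-\frac12)+\frac{c_L-3}{12}\Psi^-(-\frac32)-\Psi^+(-\frac32))$. For $p\notin\mathbb Z_{<0}$, $\mathcal F_{p,r}\cong V[p,r]$ with $v_{p,r}$ corresponding to the highest weight vector. Screening operator: for $\gamma\in\{\frac c2,c\}$ let $Y(e^\gamma,z)=\exp\left(\sum_{n\ge1}\gamma(-n)\frac{z^n}n\right)\exp\left(-\sum_{n\ge1}\gamma(n)\frac{z^{-n}}n\right)e^\gamma z^{\gamma(0)}$, where the shift operator $e^\gamma$ sends $v_{p,s}$ to $v_{p,s+1/2}$ (if $\gamma=\frac c2$) or $v_{p,s+1}$ (if $\gamma=c$) and commutes with all $\Psi^\pm(s)$ and all $c(n),d(n)$, $n\ne0$. Let $p$ be even. On $\bigoplus_{m\in\mathbb Z}\mathcal F_{p,r+m/2}$ (a $\sigma=e^{\pi id(0)}$-twisted module for $\Pi(0)^{1/2}\otimes F^{(2)}$, $\Pi(0)^{1/2}=\mathbb C[\mathbb Z\frac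 c2]\otimes M(1)$) set $a=\Psi^-(-\frac12)e^{c/2}$, $Y(a,z)=\Psi^-(z)Y(e^{c/2},z)=\sum_{j\in\frac12+\mathbb Z}a_jz^{-j-1}$, $S^{tw}=\sum_{i\ge0}\frac1{i+\frac12}a_{-i-\frac12}a_{i+\frac12}$, $e^c_0=$ coefficient of $z^{-1}$ in $Y(e^c,z)$, and $\mathcal G^{tw}=e^c_0-S^{tw}$. Thus $\mathcal G^{tw}:\mathcal F_{p,s}\to\mathcal F_{p,s+1}$. *)

(* Defs.v *)
From HB Require Import structures.
From mathcomp Require Import all_boot all_order all_algebra.
From mathcomp Require Import finmap multiset.
From mathcomp Require Import monalg.
From mathcomp Require Import boolp classical_sets fsbigop reals.
From mathcomp Require Import complex.

Set Implicit Arguments.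
Unset Strict Implicit.
Unset Printing Implicit Defensive.
Import Order.TTheory GRing.Theory Num.Theory.

Local Open Scope ring_scope.

(* Half-integer modes are indexed by their integer part: [opG X n] is
   G(n + 1/2) and [opPsi X n] is Psi(n + 1/2). *)
Record SH_ops (C : numClosedFieldType) (V : lmodType C) := SHOps {
  opL : int -> V -> V;
  opalpha : int -> V -> V;
  opG : int -> V -> V;
  opPsi : int -> V -> V;
  opCL : V -> V;
  opCa : V -> V;
  opCLa : V -> V
}.

Section SHModules.
Variable C : numClosedFieldType.

Definition comm (V : lmodType C) (A B : V -> V) : V -> V :=
  fun x => A (B x) - B (A x).
Definition acomm (V : lmodType C) (A B : V -> V) : V -> V :=
  fun x => A (B x) + B (A x).
Definition delta (k : int) : C := (k == 0)%:R.

Definition central (V : lmodType C) (X : SH_ops V) (Z : V -> V) : Prop :=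
  (forall n, comm Z (opL X n) =1 fun=> 0) /\
  (forall n, comm Z (opalpha X n) =1 fun=> 0) /\
  (forall n, comm Z (opG X n) =1 fun=> 0) /\
  (forall n, comm Z (opPsi X n) =1 fun=> 0) /\
  comm Z (opCL X) =1 (fun=> 0) /\
  comm Z (opCa X) =1 (fun=> 0) /\
  comm Z (opCLa X) =1 (fun=> 0).

Definition SH_linear (V : lmodType C) (X : SH_ops V) : Prop :=
  (forall n, linear (opL X n)) /\ (forall n, linear (opalpha X n)) /\
  (forall n, linear (opG X n)) /\ (forall n, linear (opPsi X n)) /\
  linear (opCL X) /\ linear (opCa X) /\ linear (opCLa X).

Definition is_SH_module (V : lmodType C) (X : SH_ops V) : Prop :=
  SH_linear X /\
  central X (opCL X) /\ central X (opCa X) /\ central X (opCLa X) /\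
  (forall m n x, comm (opalpha X m) (opalpha X n) x =
     (delta (m + n) * m%:~R) *: opCa X x) /\
  (forall m n x, comm (opL X m) (opalpha X n) x =
     - n%:~R *: opalpha X (m + n) x
     - (delta (m + n) * (m ^+ 2 + m)%:~R) *: opCLa X x) /\
  (forall m n x, comm (opL X m) (opL X n) x =
     (m - n)%:~R *: opL X (m + n) x
     + (delta (m + n) * ((m ^+ 3 - m)%:~R / 12)) *: opCL X x) /\
  (forall m n x, acomm (opPsi X m) (opPsi X n) x =
     delta (m + n + 1) *: opCa X x) /\
  (forall m n x, comm (opalpha X m) (opPsi X n) x = 0) /\
  (forall m n x, acomm (opG X m) (opG X n) x =
     2 *: opL X (m + n + 1) x
     + (delta (m + n + 1) * ((m ^+ 2 + m)%:~R / 3)) *: opCL X x) /\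
  (forall m n x, comm (opL X m) (opG X n) x =
     (m%:~R / 2 - n%:~R - 1 / 2) *: opG X (m + n) x) /\
  (forall m n x, comm (opalpha X m) (opG X n) x =
     m%:~R *: opPsi X (m + n) x) /\
  (forall m n x, comm (opPsi X m) (opL X n) x =
     ((2 * m + n + 1)%:~R / 2) *: opPsi X (m + n) x) /\
  (forall m n x, acomm (opPsi X m) (opG X n) x =
     opalpha X (m + n + 1) x
     + (2 * m%:~R * delta (m + n + 1)) *: opCLa X x).

(* G(n - 1/2) and Psi(n - 1/2) are [opG X (n - 1)] and [opPsi X (n - 1)]. *)
Definition SHplus_annihilates (V : lmodType C) (X : SH_ops V) (x : V) : Prop :=
  forall n : int, 1 <= n ->
    [/\ opL X n x = 0, opalpha X n x = 0,
        opG X (n - 1) x = 0 & opPsi X (n - 1) x = 0].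

Definition singular_vector (V : lmodType C) (X : SH_ops V) (x : V) : Prop :=
  x <> 0 /\ SHplus_annihilates X x.

Definition SH_hom (V W : lmodType C) (X : SH_ops V) (Y : SH_ops W)
    (f : {linear V -> W}) : Prop :=
  (forall n x, f (opL X n x) = opL Y n (f x)) /\
  (forall n x, f (opalpha X n x) = opalpha Y n (f x)) /\
  (forall n x, f (opG X n x) = opG Y n (f x)) /\
  (forall n x, f (opPsi X n x) = opPsi Y n (f x)) /\
  (forall x, f (opCL X x) = opCL Y (f x)) /\
  (forall x, f (opCa X x) = opCa Y (f x)) /\
  (forall x, f (opCLa X x) = opCLa Y (f x)).

Definition h_wt (cL p r : C) : C := (1 - p ^+ 2) * ((cL - 3) / 24) - r * p.

Definition highest_weight_conditions (cL cLa p r : C) (V : lmodType C)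
    (X : SH_ops V) (v : V) : Prop :=
  SHplus_annihilates X v /\
  opL X 0 v = h_wt cL p r *: v /\
  opalpha X 0 v = ((1 + p) * cLa) *: v /\
  opCL X v = cL *: v /\ opCa X v = 0 /\ opCLa X v = cLa *: v.

(* V is the Verma module V[p,r] with highest weight vector v, i.e. the module
   induced from the one-dimensional highest weight module of the non-negative
   part: universal among SH-modules with a vector satisfying the highest weight
   conditions. *)
Definition is_Verma (cL cLa p r : C) (V : lmodType C) (X : SH_ops V) (v : V)
    : Prop :=
  is_SH_module X /\
  highest_weight_conditions cL cLa p r X v /\
  forall (W : lmodType C) (Y : SH_ops W) (w : W),
    is_SH_module Y -> highest_weight_conditions cL cLa p r Y w ->
    exists f : {linear V -> W},
      [/\ SH_hom X Y f, f v = w &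
          forall g : {linear V -> W}, SH_hom X Y g -> g v = w -> g =1 f].

End SHModules.

Section FockSpace.
Variable C : numClosedFieldType.

(* Creation operators are indexed by bool * nat: for bosons, (false, n) stands
   for c(-n-1) and (true, n) for d(-n-1); for fermions, (false, n) stands for
   Psi^-(-n-1/2) and (true, n) for Psi^+(-n-1/2). *)
Definition gen : choiceType := (bool * nat)%type.

(* The pair (A, B) is the monomial whose bosonic factor has exponents A and
   whose fermionic factor is the product over B in increasing [fcode] order. *)
Definition monomial : choiceType := ({mset gen}%mset * {fset gen})%type.

Definition Fock : lmodType C := {malg C[monomial]}.

Definition ket (b : monomial) : Fock := << b >>.

Definition linext (f : monomial -> Fock) : Fock -> Fock :=
  fun x => \sum_(b <- msupp x) x@_b *: f b.

Definition bcreate (i : gen) : Fock -> Fock :=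
  linext (fun b => ket ((i +` b.1)%mset, b.2)).

(* partial derivative with respect to the generator i *)
Definition bderiv (i : gen) : Fock -> Fock :=
  linext (fun b => (b.1 i)%:R *: ket ((b.1 `\ i)%mset, b.2)).

Definition fcode (i : gen) : nat := (i.2.*2 + i.1)%N.

Definition fsign (i : gen) (B : {fset gen}) : C :=
  (-1) ^+ #|` [fset j in B | (fcode j < fcode i)%N]%fset |.

Definition fcreate (i : gen) : Fock -> Fock :=
  linext (fun b => if i \in b.2 then 0
                   else fsign i b.2 *: ket (b.1, (i |` b.2)%fset)).

Definition fderiv (i : gen) : Fock -> Fock :=
  linext (fun b => if i \in b.2
                   then fsign i b.2 *: ket (b.1, (b.2 `\ i)%fset) else 0).

Definition vac : Fock := ket (mset0, fset0).

(* Coordinates with respect to the basis c, d of Cc + Cd. *)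
Definition hh : lmodType C := (C^o * C^o)%type.
Definition cc : hh := (1, 0).
Definition dd : hh := (0, 1).
Definition form (g h : hh) : C := 2 * (g.1 * h.2 + g.2 * h.1).

(* The Fock module M(1) (x) F^(2) . e^w of weight w : hh has underlying space
   [Fock], with e^w being [vac]; the weight only enters through the zero modes,
   and the shift operator e^g from weight w to weight w + g is the identity of
   [Fock]. *)
Definition heis (w h : hh) (n : int) : Fock -> Fock := fun x =>
  match n with
  | Negz k => h.1 *: bcreate (false, k) x + h.2 *: bcreate (true, k) x
  | Posz 0 => form h w *: x
  | Posz k.+1 => k.+1%:R *: (form h cc *: bderiv (false, k) x
                             + form h dd *: bderiv (true, k) x)
  end.

(* Psi^+(n + 1/2) for e = true, Psi^-(n + 1/2) for e = false. *)
Definition psi (e : bool) (n : int) : Fock -> Fock :=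
  match n with
  | Negz k => fcreate (e, k)
  | Posz k => fderiv (~~ e, k)
  end.

(* A family a : modes stands for the field a(z) = \sum_n a_n z^(-n-1). Sums over
   infinite index sets are applied to vectors on which only finitely many
   terms are nonzero. *)
Definition modes := int -> Fock -> Fock.

Definition fadd (a b : modes) : modes := fun n x => a n x + b n x.
Definition fscale (t : C) (a : modes) : modes := fun n x => t *: a n x.
Definition fder (a : modes) : modes := fun n x => - n%:~R *: a (n - 1) x.

(* The normally ordered product; odd2 says whether both fields are odd. *)
Definition nprod (odd2 : bool) (a b : modes) : modes := fun n x =>
  \sum_(k \in [set k : int | k < 0]%classic) a k (b (n - 1 - k) x)
  + (-1) ^+ odd2 *:
    \sum_(k \in [set k : int | 0 <= k]%classic) b (n - 1 - k) (a k x).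

Local Notation "a :+ b" := (fadd a b) (at level 50, left associativity).
Local Notation "t :* a" := (fscale t a) (at level 40).

(* Y(omega, z) and Y(tau, z) on the Fock module of weight w, using that the
   field of a(-n-1)b(-m-1)1 is the normally ordered product of the n-th and
   m-th divided derivatives of a(z) and b(z). *)
Definition omega_modes (cL : C) (w : hh) : modes :=
  (1 / 2 :* nprod false (heis w cc) (heis w dd))
  :+ ((cL - 3) / 24 :* fder (heis w cc))
  :+ (- (1 / 2) :* fder (heis w dd))
  :+ (1 / 2 :* nprod true (fder (psi true)) (psi false))
  :+ (1 / 2 :* nprod true (fder (psi false)) (psi true)).

Definition tau_modes (cL : C) (w : hh) : modes :=
  sqrtC 2 :*
  ((1 / 2 :* nprod false (heis w cc) (psi true))
   :+ (1 / 2 :* nprod false (heis w dd) (psi false))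
   :+ ((cL - 3) / 12 :* fder (psi false))
   :+ (- 1 :* fder (psi true))).

Definition dbar (cL : C) : hh := dd - ((cL - 3) / 12) *: cc.

(* v_{p,r} is e^(wt cL p r). *)
Definition wt (cL p r : C) : hh := - ((p + 1) / 2) *: dbar cL + r *: cc.

Definition F_ops (cL cLa p r : C) : SH_ops Fock :=
  let w := wt cL p r in
  {| opL := fun n => omega_modes cL w (n + 1);
     opalpha := fun n x => - cLa *: heis w cc n x;
     opG := fun n => tau_modes cL w (n + 1);
     opPsi := fun n x => - (sqrtC 2 * cLa) *: psi false n x;
     opCL := fun x => cL *: x;
     opCa := fun _ => 0;
     opCLa := fun x => cLa *: x |}.

(* Coefficient of z^k in (\sum_(n >= 1) A_n z^n)^j. *)
Fixpoint ps_pow (A : nat -> Fock -> Fock) (j k : nat) (x : Fock) : Fock :=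
  if j is i.+1 then \sum_(1 <= n < k.+1) A n (ps_pow A i (k - n) x)
  else if k == 0%N then x else 0.

(* Coefficient of z^k in exp(\sum_(n >= 1) A_n z^n). *)
Definition ps_exp (A : nat -> Fock -> Fock) (k : nat) (x : Fock) : Fock :=
  \sum_(0 <= j < k.+1) (j`!%:R)^-1 *: ps_pow A j k x.

(* Coefficient of z^e in Y(e^g, z), from weight w to weight w + g; the factor
   z^(g(0)) acts on weight w as z^(form g w). *)
Definition Yexp (w g : hh) (e : C) (x : Fock) : Fock :=
  \sum_(kl \in [set kl : nat * nat |
                 kl.1%:R - kl.2%:R + form g w = e]%classic)
    ps_exp (fun n y => n%:R^-1 *: heis (w + g) g (- n%:Z) y) kl.1
      (ps_exp (fun n y => - n%:R^-1 *: heis (w + g) g n%:Z y) kl.2 x).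

(* a_j, the coefficient of z^(-j-1) in Psi^-(z) Y(e^(c/2), z). *)
Definition a_mode (w : hh) (j : C) (x : Fock) : Fock :=
  \sum_(n \in [set: int]%classic)
    psi false n (Yexp w ((1 / 2) *: cc) (n%:~R - j) x).

(* S^tw, e^c_0 and G^tw, as maps F_{p,s} -> F_{p,s+1}. *)
Definition Stw (cL p s : C) (x : Fock) : Fock :=
  \sum_(i \in [set: nat]%classic)
    (i%:R + 1 / 2)^-1 *:
      a_mode (wt cL p (s + 1 / 2)) (- i%:R - 1 / 2)
        (a_mode (wt cL p s) (i%:R + 1 / 2) x).

Definition ec0 (cL p s : C) (x : Fock) : Fock := Yexp (wt cL p s) cc (- 1) x.

Definition Gtw (cL p s : C) (x : Fock) : Fock := ec0 cL p s x - Stw cL p s x.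

(* (G^tw)^n : F_{p,s} -> F_{p,s+n} *)
Fixpoint Gtw_pow (cL p s : C) (n : nat) (x : Fock) : Fock :=
  if n is m.+1 then Gtw cL p (s + m%:R) (Gtw_pow cL p s m x) else x.

(* u_{p,r}^(n) = (G^tw)^n v_{p,r-n} *)
Definition u_vec (cL p r : C) (n : nat) : Fock := Gtw_pow cL p (r - n%:R) n vac.

End FockSpace.

Arguments vac {C}.

(* Main.v *)
Require Import Defs.
From HB Require Import structures.
From mathcomp Require Import all_boot all_order all_algebra.
From mathcomp Require Import finmap multiset monalg.
From mathcomp Require Import boolp classical_sets fsbigop.
From mathcomp Require Import reals complex.
From mathcomp Require Import ring zify.
Set Implicit Arguments.
Unset Strict Implicit.
Unset Printing Implicit Defensive.
Import Order.TTheory GRing.Theory Num.Theory.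
Local Open Scope ring_scope.

(** Why the vectors [(G^tw)^n v_(p,r-n)] are singular.

    The highest weight vector generates, under the creation operators [c(-n)]
    and [Psi^-(-n-1/2)], a subspace of the Fock space on which every [c(n)] with
    [n > 0] and every [Psi^-(n-1/2)] with [n > 0] acts by zero. Vertex operators
    built from [c] and [Psi^-] alone therefore act on it by multiplication. Put
    [u(z) = sum_(n>0) c(-n) z^n / (2n)], [psi(z) = sum_m Psi^-(-m-1/2) z^m],
    [E = exp u], [F = psi E] and [p = 2q]. Then [G^tw] is multiplication by
    [g = (E^2)_(2q) - sum_(i<q) F_(q+i) F_(q-1-i) / (i + 1/2)], whatever the
    weight ([GtwE]), and the vector in question is [g^n] applied to the vacuum.

    On the same subspace [alpha(n)] and [Psi(n-1/2)], [n > 0], act by zero, and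
    [G(n+1/2) / sqrt 2] and [L(n+1)], [n >= 0], act as an odd and an even
    superderivation ([tau_modesE], [omega_modesE]). The odd one, [D], is
    determined by [D u = z^(n+1) psi / 2] and
    [D psi = z^n (z u' + n - q + 1/2)]. The uniqueness of solutions of
    [z X' = z u' X] with [X_0 = 0] turns the first relation into
    [D E = z^(n+1) psi E / 2]; since [psi^2 = 0], the second one then gives
    [D F_k = (k - q + 1/2) E_(k-n)]. Hence [D (E^2) = z^(n+1) F E], while the
    denominators [i + 1/2] are exactly those for which [D] maps the quadratic
    term of [g] to the same coefficient of [z^(n+1) F E]. So [D g = 0]
    ([odd_der_screening]). The operator [L(n+1)] has the same effect on the
    generators as the anticommutator of the odd derivations attached to [0] and
    [n], so it kills [g] too ([even_der_screening]). All these derivations kill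
    the vacuum, hence [g^n] applied to the vacuum.

    The vector is nonzero because the character of the subspace sending [c(-1)]
    to [1] and the other generators to [0] sends [E^2] to [exp z], thus [g] to
    [1 / (2q)!] ([screening_character]). The statement for a Verma module is
    transported along the isomorphism.

    Derivations are expressed by commutators and anticommutators in the ring of
    linear endomorphisms of the Fock space, and generating functions by power
    series with coefficients in that noncommutative ring. *)

(** * Power series over a noncommutative ring *)

Definition pseries (R : nzRingType) := nat -> R.

Section PseriesRing.
Variable R : nzRingType.
Implicit Types a b c : pseries R.

HB.instance Definition _ := gen_eqMixin (pseries R).
HB.instance Definition _ := gen_choiceMixin (pseries R).

Definition ps_zero : pseries R := fun=> 0.
Definition ps_opp a : pseries R := fun k => - a k.
Definition ps_add a b : pseries R := fun k => a k + b k.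

Fact ps_addA : associative ps_add.
Proof. by move=> a b c; apply/funext=> k; exact: addrA. Qed.
Fact ps_addC : commutative ps_add.
Proof. by move=> a b; apply/funext=> k; exact: addrC. Qed.
Fact ps_add0 : left_id ps_zero ps_add.
Proof. by move=> a; apply/funext=> k; exact: add0r. Qed.
Fact ps_addN : left_inverse ps_zero ps_opp ps_add.
Proof. by move=> a; apply/funext=> k; exact: addNr. Qed.

HB.instance Definition _ :=
  GRing.isZmodule.Build (pseries R) ps_addA ps_addC ps_add0 ps_addN.

Definition ps_cst (x : R) : pseries R := fun k => if k is 0 then x else 0.
Definition ps_mul a b : pseries R := fun k => \sum_(i < k.+1) a i * b (k - i)%N.

(** Coefficientwise the product is that of truncated polynomials, from which it
    inherits associativity. *)
Fact ps_mulE a b k N : (k < N)%N ->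
  ps_mul a b k = (\poly_(i < N) a i * \poly_(i < N) b i)`_k.
Proof.
move=> kN; rewrite coefM; apply: eq_bigr => i _.
rewrite !coef_poly (leq_trans (ltn_ord i)) //.
by rewrite (leq_ltn_trans (leq_subr _ _) kN).
Qed.

Fact ps_mulA : associative ps_mul.
Proof.
move=> a b c; apply/funext=> k.
transitivity ((\poly_(i < k.+1) a i * (\poly_(i < k.+1) b i
                 * \poly_(i < k.+1) c i))`_k); last rewrite mulrA.
  rewrite coefM; apply: eq_bigr => i _; rewrite coef_poly ltn_ord.
  by rewrite -ps_mulE // ltnS leq_subr.
rewrite coefM; apply: eq_bigr => i _.
by rewrite -ps_mulE // coef_poly ltnS leq_subr.
Qed.
Fact ps_mul1 : left_id (ps_cst 1) ps_mul.
Proof.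
move=> a; apply/funext=> k; rewrite /ps_mul big_ord_recl mul1r subn0.
by rewrite big1 ?addr0 // => i _; rewrite mul0r.
Qed.
Fact ps_mulr1 : right_id (ps_cst 1) ps_mul.
Proof.
move=> a; apply/funext=> k; rewrite /ps_mul big_ord_recr /= subnn mulr1.
by rewrite big1 ?add0r // => i _; rewrite -(subnSK (ltn_ord i)) mulr0.
Qed.
Fact ps_mulDl : left_distributive ps_mul +%R.
Proof.
move=> a b c; apply/funext=> k; rewrite -[RHS]big_split.
by apply: eq_bigr => i _; exact: mulrDl.
Qed.
Fact ps_mulDr : right_distributive ps_mul +%R.
Proof.
move=> a b c; apply/funext=> k; rewrite -[RHS]big_split.
by apply: eq_bigr => i _; exact: mulrDr.
Qed.
Fact ps_oner_neq0 : ps_cst 1 != ps_zero.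
Proof. by apply/eqP=> /(congr1 (@^~ 0%N))/eqP; rewrite oner_eq0. Qed.

HB.instance Definition _ := GRing.Zmodule_isNzRing.Build (pseries R)
  ps_mulA ps_mul1 ps_mulr1 ps_mulDl ps_mulDr ps_oner_neq0.

Lemma psD a b k : (a + b) k = a k + b k. Proof. by []. Qed.
Lemma psN a k : (- a) k = - a k. Proof. by []. Qed.
Lemma psM a b k : (a * b) k = \sum_(i < k.+1) a i * b (k - i)%N.
Proof. by []. Qed.
Lemma psM0 a b : (a * b) 0%N = a 0%N * b 0%N.
Proof. by rewrite psM big_ord1. Qed.
Lemma ps_cstMl x a k : (ps_cst x * a) k = x * a k.
Proof.
rewrite psM big_ord_recl subn0 big1 ?addr0 // => i _; exact: mul0r.
Qed.
Lemma ps_cstMr x a k : (a * ps_cst x) k = a k * x.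
Proof.
rewrite psM big_ord_recr /= subnn big1 ?add0r // => i _.
by rewrite -(subnSK (ltn_ord i)) mulr0.
Qed.

Lemma ps_comm a b : (forall i j, GRing.comm (a i) (b j)) -> GRing.comm a b.
Proof.
move=> ab; apply/funext=> k; rewrite !psM (reindex_inj rev_ord_inj) /=.
by apply: eq_bigr => i _; rewrite ab subSS subKn // -ltnS.
Qed.

(** The monomial [z ^ n]. *)
Definition ps_var n : pseries R := fun k => (k == n)%:R.

Lemma ps_varM n a k :
  (ps_var n * a) k = if (n <= k)%N then a (k - n)%N else 0.
Proof.
rewrite psM /ps_var; case: leqP => [nk|kn].
  have nk1 : (n < k.+1)%N by [].
  rewrite (bigD1 (Ordinal nk1)) //= eqxx mul1r big1 ?addr0 // => i.
  by rewrite -val_eqE /= => /negPf ->; rewrite mul0r.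
by rewrite big1 // => i _; rewrite ltn_eqF ?mul0r // (leq_trans (ltn_ord i)).
Qed.

Lemma ps_var_comm n a : GRing.comm (ps_var n) a.
Proof. by apply: ps_comm => i j; exact: commr_sym (commr_nat _ _). Qed.

(** The derivation [z d/dz]. *)
Definition ps_der (a : pseries R) : pseries R := fun k => a k *+ k.

Lemma ps_derD a b : ps_der (a + b) = ps_der a + ps_der b.
Proof. by apply/funext=> k; exact: mulrnDl. Qed.
Lemma ps_derN a : ps_der (- a) = - ps_der a.
Proof. by apply/funext=> k; exact: mulNrn. Qed.
Lemma ps_derM a b : ps_der (a * b) = ps_der a * b + a * ps_der b.
Proof.
apply/funext=> k; rewrite /ps_der psD !psM -sumrMnl -big_split /=.
apply: eq_bigr => i _; rewrite mulrnAl mulrnAr -mulrnDr subnKC //.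
by rewrite -ltnS.
Qed.
Lemma ps_der_cst x : ps_der (ps_cst x) = 0.
Proof. by apply/funext=> -[|k]; rewrite /ps_der ?mulr0n ?mul0rn. Qed.
End PseriesRing.

Section Exponential.
Variables (C : numFieldType) (R : algType C).
Implicit Types a b u x : pseries R.

(** The coefficient of [z^k] of the equation reads [k x_k = sum a_i x_(k-i)],
    where only [x_j] with [j < k] occur because [a] has no constant term. Two
    series built from exponentials are compared below by showing that their
    difference solves such an equation. *)
Lemma ode_uniq a x :
  a 0%N = 0 -> x 0%N = 0 -> ps_der x = a * x -> x = 0.
Proof.
move=> a0 x0 xE; apply/funext=> k; have [m] := ubnP k.
elim: m k => // m IHm [|k] km; first exact: x0.
have /(congr1 (@^~ k.+1)) := xE; rewrite /ps_der psM big1 => [|i _].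
  by move/eqP; rewrite -scaler_nat scaler_eq0 pnatr_eq0 /= => /eqP.
case: i => -[|i] /= ik; first by rewrite a0 mul0r.
by rewrite IHm ?mulr0 //; lia.
Qed.

Definition expseries u : pseries R :=
  fun k => \sum_(j < k.+1) (j`!%:R)^-1 *: (u ^+ j) k.

Variable u : pseries R.
Hypothesis u0 : u 0%N = 0.

(** Since [u] has no constant term, only finitely many powers contribute to each
    coefficient of the exponential. *)
Lemma psX_low j k : (k < j)%N -> (u ^+ j) k = 0.
Proof.
elim: j k => // j IHj k kj; rewrite exprS psM big1 // => i _.
case: i => -[|i] /= ik; first by rewrite u0 mul0r.
by rewrite IHj ?mulr0 //; lia.
Qed.

Lemma expseries_widen k N : (k <= N)%N ->
  expseries u k = \sum_(j < N.+1) (j`!%:R)^-1 *: (u ^+ j) k.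
Proof.
move=> kN; rewrite /expseries (big_ord_widen N.+1
  (fun j => (j`!%:R)^-1 *: (u ^+ j) k)) //
    [RHS](bigID (fun j : 'I__ => j < k.+1)%N) /=.
rewrite [X in _ + X]big1 ?addr0 // => j; rewrite -leqNgt => kj.
by rewrite psX_low ?scaler0.
Qed.

Lemma expseries0 : expseries u 0%N = 1.
Proof. by rewrite /expseries big_ord1 /= invr1 scale1r. Qed.

Lemma comm_expseries (y : R) :
  (forall k, GRing.comm y (u k)) -> forall k, GRing.comm y (expseries u k).
Proof.
move=> yu k; apply: commr_sum => j _.
have : GRing.comm (ps_cst y) u.
  by apply: ps_comm => -[|i] m; [exact: yu | exact: commr_sym (commr0 _)].
move=> /(@commrX _ _ _ j)/(congr1 (@^~ k)); rewrite ps_cstMl ps_cstMr.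
by rewrite /GRing.comm -scalerAl -scalerAr => ->.
Qed.

Hypothesis u_comm : forall i j, GRing.comm (u i) (u j).

Lemma ps_der_exp : ps_der (expseries u) = ps_der u * expseries u.
Proof.
have uC : GRing.comm u (ps_der u).
  by apply: ps_comm => i j; apply: commrMn; exact: u_comm.
have derX j : ps_der (u ^+ j.+1) = (ps_der u * u ^+ j) *+ j.+1.
  elim: j => [|j IHj]; first by rewrite mulr1.
  rewrite {1}exprS ps_derM IHj [RHS]mulrS; congr (_ + _).
  by rewrite mulrnAr mulrA uC -mulrA -exprS.
apply/funext=> k; rewrite psM /ps_der.
rewrite (@expseries_widen k k.+1) // big_ord_recl mulrnDl.
rewrite [X in X + _](_ : _ = 0) ?add0r; last first.
  rewrite fact0 invr1 scale1r expr0.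
  by case: k => [|k]; rewrite ?mulr0n // -[LHS]/(0 *+ k.+1) mul0rn.
rewrite -sumrMnl.
under [RHS]eq_bigr => i _ do
  rewrite (@expseries_widen _ k) ?leq_subr // mulr_sumr.
rewrite exchange_big; apply: eq_bigr => j _ /=.
have -> : \sum_(i < k.+1) ps_der u i * ((j`!%:R)^-1 *: (u ^+ j) (k - i)%N)
    = (j`!%:R)^-1 *: (ps_der u * u ^+ j) k.
  by rewrite psM scaler_sumr; apply: eq_bigr => i _; rewrite scalerAr.
have /(congr1 (@^~ k)) := derX j; rewrite {1}/ps_der [bump 0 j]add1n scalerMnr
  => ->.
have -> (v : pseries R) m : (v *+ m) k = v k *+ m.
  by elim: m => [|m IHm]; rewrite ?mulr0n // !mulrS psD IHm.
rewrite -scaler_nat scalerA factS natrM invfM mulrAC mulVf ?mul1r //.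
by rewrite pnatr_eq0.
Qed.
End Exponential.

(** * The screening element and the derivations that kill it *)

Section Screening.
Variables (C : numFieldType) (R : algType C) (u psi : pseries R).
Hypothesis u0 : u 0%N = 0.
Hypothesis uu : forall i j, GRing.comm (u i) (u j).
Hypothesis upsi : forall i j, GRing.comm (u i) (psi j).
Hypothesis psipsi : forall i j, psi i * psi j = - (psi j * psi i).

Let E := expseries u.
Let F := psi * E.

Fact addxx_eq0 (V : lmodType C) (x : V) : x + x = 0 -> x = 0.
Proof.
move/eqP; rewrite -mulr2n -scaler_nat scaler_eq0 pnatr_eq0 /=.
by move/eqP.
Qed.

(** Both sides solve [z X' = 2 z u' X] with constant term [1]. *)
Lemma expseries_double : expseries (u + u) = E * E.
Proof.
have der0 : ps_der u 0%N = 0 by [].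
have uu0 : (u + u) 0%N = 0 by rewrite psD u0 addr0.
have uuC i j : GRing.comm ((u + u) i) ((u + u) j).
  by rewrite !psD; apply: commrD; apply: commr_sym; apply: commrD; exact: uu.
have EU : GRing.comm E (ps_der u).
  apply: ps_comm => i j; apply: commr_sym; apply: comm_expseries => k.
  by apply: commr_sym; apply: commrMn; exact: uu.
apply/eqP; rewrite -subr_eq0; apply/eqP.
apply: (@ode_uniq _ _ (ps_der u + ps_der u)).
- by rewrite psD der0 addr0.
- by rewrite psD psN psM0 /E !expseries0 // mulr1 subrr.
rewrite ps_derD ps_derN ps_derM !ps_der_exp //.
by rewrite ps_derD -/E [E * (_ * _)]mulrA EU mulrBr !mulrDl !mulrA.
Qed.

Lemma psi_sq : psi * psi = 0.
Proof.
apply/funext=> k; apply: addxx_eq0.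
rewrite {2}psM (reindex_inj rev_ord_inj) psM -big_split big1 //= => i _.
by rewrite subSS subKn ?(psipsi (k - i)%N) ?subrr // -ltnS.
Qed.

Section OddDerivation.
Variables (D : R) (n : nat) (kappa : C).

(** The commutation relations with [D] of the modes of [u] and [psi] that hold
    for the odd derivation [u |-> z^(n+1) psi / 2],
    [psi |-> z^n (z u' + kappa)]. *)
Definition odd_der :=
  (forall k, D * u k - u k * D =
             if (n < k)%N then 2^-1 *: psi (k - n.+1)%N else 0)
  /\ forall m, D * psi m + psi m * D =
             (if (n <= m)%N then u (m - n)%N *+ (m - n) else 0)
             + ((m == n)%:R * kappa)%:A.

Hypothesis hD : odd_der.
Let d := ps_cst D.
Let beta : pseries R := fun k =>
  if (n < k)%N then 2^-1 *: psi (k - n.+1)%N else 0.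

Fact beta_double : beta + beta = ps_var R n.+1 * psi.
Proof.
apply/funext=> k; rewrite psD ps_varM /beta; case: ifP => _; last exact: addr0.
by rewrite -scalerDl (_ : _ + _ = 1) ?scale1r //; field.
Qed.

(** The difference of the two sides solves [z X' = z u' X]. *)
Fact odd_der_E : d * E - E * d = beta * E.
Proof.
have du : d * u - u * d = beta.
  by apply/funext=> k; rewrite psD psN ps_cstMl ps_cstMr hD.1.
have bu : GRing.comm beta (ps_der u).
  apply: ps_comm => i j; apply: commrMn; rewrite /beta.
  case: ifP => _; last exact/commr_sym/commr0.
  by rewrite /GRing.comm -scalerAl -scalerAr upsi.
have dder : d * ps_der u - ps_der u * d = ps_der beta.
  rewrite -du ps_derD ps_derN !ps_derM ps_der_cst mul0r mulr0 addr0 add0r //.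
apply/eqP; rewrite -subr_eq0; apply/eqP.
apply: (@ode_uniq _ _ (ps_der u)) => //.
  rewrite !(psD, psN) ps_cstMl ps_cstMr psM0 /E expseries0 // mulr1 mul1r.
  by rewrite subrr mul0r subrr.
rewrite !(ps_derD, ps_derN, ps_derM) ps_der_cst mul0r mulr0 addr0 add0r.
rewrite !ps_der_exp // -/E -dder !mulrBr mulrBl !mulrA bu.
by rewrite opprD opprB addrA [X in X - _]addrC subrKA.
Qed.

Fact comm_E_beta : GRing.comm E beta.
Proof.
apply: ps_comm => i j; apply: commr_sym; apply: comm_expseries => k.
rewrite /beta; case: ifP => _; last exact/commr_sym/commr0.
by rewrite /GRing.comm -scalerAl -scalerAr upsi.
Qed.

Fact psi_beta : psi * beta = 0.
Proof.
apply/funext=> k; apply: addxx_eq0; rewrite -psD -mulrDr beta_double.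
by rewrite mulrA -ps_var_comm -mulrA psi_sq mulr0.
Qed.

(** In [D (psi E) = (D psi) E - psi (D E)] the last term contains [psi^2] and
    vanishes; what remains is [z^n (z u' + kappa) E = z^n (z E' + kappa E)]. *)
Lemma odd_der_F m : D * F m + F m * D =
  if (n <= m)%N then ((m - n)%:R + kappa) *: E (m - n)%N else 0.
Proof.
have dpsi : d * psi + psi * d = ps_var R n * (ps_der u + ps_cst kappa%:A).
  apply/funext=> k; rewrite psD ps_cstMl ps_cstMr hD.2 ps_varM.
  case: (ltngtP n k) => nk; rewrite ?mul0r ?scale0r ?addr0 //.
  - rewrite psD [ps_cst _ _](_ : _ = 0) ?addr0 //.
    by rewrite -(subnSK nk).
  - by rewrite nk mul1r subnn psD.
have -> : D * F m + F m * D = (d * F + F * d) m.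
  by rewrite psD ps_cstMl ps_cstMr.
have -> : d * F + F * d = ps_var R n * (ps_der E + ps_cst kappa%:A * E).
  have -> : d * F + F * d = (d * psi + psi * d) * E - psi * (d * E - E * d).
    by rewrite mulrDl mulrBr opprB /F !mulrA [_ - psi * d * E]addrC addrA addrK.
  by rewrite odd_der_E mulrA psi_beta mul0r subr0 dpsi -mulrA mulrDl ps_der_exp.
rewrite ps_varM; case: ifP => // _.
by rewrite psD ps_cstMl -scalerAl mul1r scalerDl scaler_nat.
Qed.

Lemma odd_der_H k : D * (E * E) k - (E * E) k * D =
  if (n < k)%N then (F * E) (k - n.+1)%N else 0.
Proof.
rewrite -ps_varM -ps_cstMl -ps_cstMr -psN -psD; congr (_ k).
have -> : ps_cst D * (E * E) - E * E * ps_cst D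
    = (d * E - E * d) * E + E * (d * E - E * d).
  by rewrite mulrBl mulrBr !mulrA addrA subrK.
rewrite odd_der_E mulrA comm_E_beta -mulrA -mulrA -mulrDl beta_double.
by rewrite /F !mulrA.
Qed.

End OddDerivation.

Variable q : nat.

(** The element by which [G^tw] multiplies when [p = 2q]; note that
    [expseries (u + u)] is [E^2]. *)
Definition screening : R := expseries (u + u) q.*2 -
  \sum_(i < q) (i%:R + 2^-1)^-1 *: (F (q + i)%N * F (q - i.+1)%N).

Fact comm_E_F i j : GRing.comm (E i) (F j).
Proof.
rewrite /F psM; apply: commr_sum => m _; apply: commrM.
  apply: commr_sym; apply: comm_expseries => k; exact/commr_sym/upsi.
apply: comm_expseries => k; apply: commr_sym; apply: comm_expseries => l;
  exact: uu.
Qed.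

(** With [kappa = n - q + 1/2] the factor in [odd_der_F] is [i + 1/2] at
    [F_(q+i)] and [- (i + 1/2)] at [F_(q-1-i)]. It cancels the denominators, and
    the derivative of the quadratic part becomes [sum_(m<2q) F_m e_(2q-1-m)]
    with [e = z^n E], which is the coefficient given by [odd_der_H]. *)
Lemma odd_der_screening D n :
  odd_der D n (n%:R - q%:R + 2^-1) -> D * screening = screening * D.
Proof.
move=> hD; apply/eqP; rewrite -subr_eq0 /screening expseries_double.
rewrite mulrBr mulrBl opprB [_ * D - _]addrC addrACA (odd_der_H hD) [- _ +
  _]addrC.
rewrite mulr_sumr mulr_suml -sumrB.
(* [e] absorbs the shift by [n], so that no case distinction on [n] is left. *)
pose e k := (ps_var R n * E) k.
have -> : (if (n < q.*2)%N then (F * E) (q.*2 - n.+1)%N else 0)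
    = \sum_(m < q + q) F m * e (q + q - m.+1)%N.
  case: q => [|k]; first by rewrite big_ord0.
  rewrite doubleS addSn addnS addnn subSS ltnS -ps_varM.
  by rewrite mulrA ps_var_comm -mulrA psM.
(* The lower half [m < q], read backwards, pairs with the upper half. *)
rewrite big_split_ord (reindex_inj rev_ord_inj) /= -big_split /= -big_split /=.
apply/eqP; rewrite big1 // => i _.
have iq := ltn_ord i.
have -> : (q + q - (q - i.+1).+1 = q + i)%N by lia.
have -> : (q + q - (q + i).+1 = q - i.+1)%N by lia.
have lin k : D * F k + F k * D = (k%:R - q%:R + 2^-1) *: e k.
  rewrite (odd_der_F hD) /e ps_varM; case: ifP => nk; last by rewrite scaler0.
  by congr (_ *: _); rewrite natrB //; ring.
have -> (x y : R) : (i%:R + 2^-1)^-1 *: (x * y) * D - D * ((i%:R + 2^-1)^-1 *: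
  (x * y))
    = (i%:R + 2^-1)^-1 *: (x * (D * y + y * D) - (D * x + x * D) * y).
  rewrite -scalerAl -scalerAr -scalerBr; congr (_ *: _).
  by rewrite mulrDr mulrDl !mulrA opprD addrA addrAC [x * D * y + _]addrC addrK.
have i0 : i%:R + 2^-1 != 0 :> C.
  by rewrite gt_eqF // ltr_wpDl ?invr_gt0.
rewrite !lin natrD natrB //.
rewrite (_ : q%:R - i.+1%:R - q%:R + 2^-1 = - (i%:R + 2^-1)); last first.
  by rewrite -[i.+1]addn1 natrD; field.
rewrite (_ : q%:R + i%:R - q%:R + 2^-1 = i%:R + 2^-1); last by ring.
rewrite scaleNr mulrN -scalerAr -scalerAl -opprD -scalerDr scalerN.
rewrite scalerA mulVf // scale1r.
have -> : e (q + i)%N * F (q - i.+1)%N = F (q - i.+1)%N * e (q + i)%N.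
  rewrite /e ps_varM; case: ifP => _; [exact: comm_E_F | by rewrite mul0r
    mulr0].
by rewrite [X in X - _]addrC subrr.
Qed.

(** The products [F_a F_b] are quadratic in [psi], so the two signs cancel for
    an operator that anticommutes with [psi]. *)
Lemma comm_screening x :
  (forall k, GRing.comm x (u k)) ->
  (forall k, GRing.comm x (psi k)) \/ (forall k, x * psi k = - (psi k * x)) ->
  GRing.comm x screening.
Proof.
move=> xu xpsi.
have xE k : GRing.comm x (E k) by exact: comm_expseries.
have xF : (forall k, GRing.comm x (F k)) \/ (forall k, x * F k = - (F k * x)).
  case: xpsi => xpsi; [left | right] => k; rewrite /F psM.
    by apply: commr_sum => i _; exact: commrM.
  rewrite mulr_sumr mulr_suml -sumrN; apply: eq_bigr => i _.
  by rewrite mulrA xpsi mulNr -!mulrA xE.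
apply: commrB; first by apply: comm_expseries => k; exact: commrD.
apply: commr_sum => i _; rewrite /GRing.comm -scalerAl -scalerAr.
congr (_ *: _); case: xF => xF; first exact: commrM.
by rewrite mulrA xF mulNr -!mulrA xF mulrN opprK.
Qed.

Fact bracket_regroup (V : zmodType) (a b c d e f : V) :
  a + b - (c + d) = a - e + (f - d) + (b - f + (e - c)).
Proof.
rewrite [RHS]addrACA [a - e + _]addrACA [f - d + _]addrACA -!opprD.
by rewrite addrA [f + e]addrC subrK [d + c]addrC.
Qed.

Fact superbracket_regroup (V : zmodType) (a b c d e f : V) :
  a + b - (c + d) = a + e - (f + d) + (b + f - (e + c)).
Proof.
rewrite [RHS]addrACA [a + e + _]addrACA -opprD [f + d + _]addrACA [f + e]addrC.
by rewrite addrKA [d + c]addrC.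
Qed.

(** The relations satisfied by the mode [L(n)] of the conformal vector, for the
    parameter [p = 2q]. *)
Definition even_der (L : R) n :=
  (forall k, L * u k - u k * L =
     (if (n <= k)%N then u (k - n)%N *+ (k - n) else 0)
     + ((k == n)%:R * (n%:R / 2 - q%:R))%:A)
  /\ forall m, L * psi m - psi m * L =
     if (n <= m)%N then ((m - n)%:R + (n%:R + 1) / 2) *: psi (m - n)%N else 0.

(** The anticommutator of the odd derivations of degrees [0] and [n] has the
    same brackets with [u] and [psi] as [L]; the difference commutes with all
    generators, hence with the screening element. *)
Lemma even_der_screening L D0 D n :
  odd_der D0 0 (2^-1 - q%:R) -> odd_der D n (n%:R - q%:R + 2^-1) ->
  even_der L n.+1 -> L * screening = screening * L.
Proof.
move=> h0 hD [hLu hLpsi].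
have c0 : D0 * screening = screening * D0.
  by apply: (@odd_der_screening _ 0); rewrite sub0r addrC.
have cD := odd_der_screening hD.
suff LX : GRing.comm screening (L - (D0 * D + D * D0)).
  rewrite -[L](subrK (D0 * D + D * D0)); apply/esym/commrD => //.
  by apply: commrD; apply: commrM => //; exact/commr_sym.
apply/commr_sym.
have uE k : (D0 * D + D * D0) * u k - u k * (D0 * D + D * D0)
  = (D0 * (D * u k - u k * D) + (D * u k - u k * D) * D0)
  + (D * (D0 * u k - u k * D0) + (D0 * u k - u k * D0) * D).
  rewrite !mulrDl !mulrDr !(mulrN, mulNr) !mulrA.
  exact: bracket_regroup.
have psiE k : (D0 * D + D * D0) * psi k - psi k * (D0 * D + D * D0)
  = (D0 * (D * psi k + psi k * D) - (D * psi k + psi k * D) * D0)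
  + (D * (D0 * psi k + psi k * D0) - (D0 * psi k + psi k * D0) * D).
  rewrite !mulrDl !mulrDr !mulrA.
  exact: superbracket_regroup.
have subC (x y z : R) : (x - y) * z - z * (x - y) = (x * z - z * x) - (y * z -
  z * y).
  by rewrite mulrBl mulrBr !opprB [z * y - z * x]addrC addrACA [- _ + _]addrC.
apply: comm_screening => [k|]; [|left => k];
  rewrite /GRing.comm; apply/eqP; rewrite -subr_eq0;
  rewrite subC subr_eq0.
  have half (x y : R) : x * (2^-1 *: y) + (2^-1 *: y) * x = 2^-1 *: (x * y + y
    * x).
    by rewrite -scalerAr -scalerAl scalerDr.
  rewrite hLu uE h0.1 hD.1; apply/eqP; case: k => [|k].
    by rewrite /= !(mulr0, mul0r, scale0r, addr0).
  rewrite ltnS subSS subn1 /= [in X in _ = _ + X]half hD.2 eqSS.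
  case: (ltngtP n k) => nk.
  - rewrite half h0.2 subn0 leq0n subn_eq0 leqNgt nk /= !mul0r !scale0r !addr0.
    by rewrite -scalerDl (_ : _ + _ = 1) ?scale1r //; field.
  - by rewrite !(mulr0, mul0r, scale0r, addr0, scaler0).
  - rewrite half h0.2 nk subnn /= !mulr0n !add0r !mul1r -scalerDr -scalerDl.
    by rewrite scalerA; congr (_ *: _); rewrite -natr1; field.
have dropA (x y : R) (c : C) : x * (y + c%:A) - (y + c%:A) * x = x * y - y * x.
  rewrite mulrDr mulrDl opprD addrACA -scalerAr -scalerAl mulr1 mul1r.
  by rewrite subrr addr0.
have brMn (x y : R) m : x * (y *+ m) - (y *+ m) * x = (x * y - y * x) *+ m.
  by rewrite mulrnAr mulrnAl mulrnBl.
rewrite hLpsi psiE h0.2 hD.2 !dropA subn0 (brMn D) hD.1; apply/eqP.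
case: (ltngtP n k) => nk.
- rewrite brMn h0.1 subn_gt0 nk subn1 -subnS -!scaler_nat !scalerA -scalerDl.
  by congr (_ *: _); rewrite !natrB // ?(ltnW nk) // -natr1; field.
- by rewrite mulr0 mul0r subrr mul0rn addr0.
- by rewrite nk subnn mulr0n mulr0 mul0r subrr mul0rn addr0.
Qed.

(** A character [chi] that keeps only [u_1] annihilates the quadratic part and
    turns [E^2] into [exp (2tz)]. *)
Lemma screening_character chi (t : C) :
  (forall k, chi * u k = if k == 1%N then t *: chi else 0) ->
  (forall k, chi * psi k = 0) ->
  chi * screening = ((2 * t) ^+ q.*2 / q.*2`!%:R) *: chi.
Proof.
move=> chiu chipsi.
have chiF k : chi * F k = 0.
  by rewrite /F psM mulr_sumr big1 // => i _; rewrite mulrA chipsi mul0r.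
rewrite /screening mulrBr [X in _ - X]mulr_sumr [X in _ - X]big1 ?subr0;
  last first.
  by move=> i _; rewrite -scalerAr mulrA chiF mul0r scaler0.
have uu0 : (u + u) 0%N = 0 by rewrite psD u0 addr0.
have uuC i j : GRing.comm ((u + u) i) ((u + u) j).
  by rewrite !psD; apply: commrD; apply: commr_sym; apply: commrD; exact: uu.
have := ps_der_exp uu0 uuC; have := expseries0 (u + u).
move: (expseries _) => h h0 derh.
elim: (q.*2) => [|k IHk]; first by rewrite h0 mulr1 expr0 mul1r invr1 scale1r.
have /(congr1 (fun a : pseries R => chi * a k.+1)) := derh.
rewrite psM big_ord_recl big_ord_recl /ps_der /= mulr0n mul0r add0r mulrDr.
rewrite [X in _ + X]mulr_sumr [X in _ + X]big1 ?addr0 => [|i _]; last first.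
  by rewrite mulrA mulrnAr psD mulrDr !chiu /= addr0 mul0rn mul0r.
rewrite mulr1n mulrA psD mulrDr chiu eqxx -scalerDl subSS subn0 -scalerAl IHk.
rewrite -scaler_nat -scalerAr scalerA => chik.
have k1 : k.+1%:R != 0 :> C by rewrite pnatr_eq0.
rewrite -[LHS](scalerK k1) chik scalerA factS natrM exprS; congr (_ *: _).
have k2 : k`!%:R != 0 :> C by rewrite pnatr_eq0 -lt0n fact_gt0.
by field; rewrite k2 addrC natr1.
Qed.
End Screening.

(** * The algebra of endomorphisms of the Fock space *)

Section EndoRing.
Variable C : numClosedFieldType.
Implicit Types (x y : Fock C).

Lemma linext_linear (f : monomial -> Fock C) : linear (linext f).
Proof.
have linextw (D : {fset monomial}) x : (msupp x `<=` D)%fset ->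
    linext f x = \sum_(b <- D) x@_b *: f b.
  move=> xD; rewrite /linext (big_fset_incl _ xD) // => b _ bx.
  by rewrite mcoeff_outdom // scale0r.
move=> a x y; pose D := (msupp (a *: x + y) `|` msupp x `|` msupp y)%fset.
rewrite !(linextw D) ?fsubsetUr //; last first.
- by rewrite /D -fsetUA fsubsetUl.
- by rewrite /D fsetUAC fsubsetUr.
rewrite scaler_sumr -big_split; apply: eq_bigr => b _ /=.
by rewrite mcoeffD mcoeffZ scalerDl scalerA.
Qed.

Lemma linext_ket (f : monomial -> Fock C) b : linext f (ket C b) = f b.
Proof.
by rewrite /linext /ket msuppU oner_eq0 big_seq_fset1 mcoeffUU scale1r.
Qed.

Lemma ket_expand x : x = \sum_(b <- msupp x) x@_b *: ket C b.
Proof.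
rewrite {1}[x]monalgE; apply: eq_bigr => b _.
by apply/malgP => k; rewrite mcoeffZ !mcoeffU mulrnAr mulr1.
Qed.

(** The coercion [endo_fun] is a constant rather than the projection itself:
    a rewriting pattern headed by a projection would be tried against every
    term. *)
Record endo := Endo { endo_val : Fock C -> Fock C;
  endo_linear : linear endo_val }.
Definition endo_fun (f : endo) : Fock C -> Fock C := endo_val f.
Coercion endo_fun : endo >-> Funclass.

HB.instance Definition _ (f : endo) :=
  GRing.isLinear.Build C (Fock C) (Fock C) _ (endo_fun f)
    (@endo_linear f).

Lemma endo_eq (f g : endo) : f =1 g -> f = g.
Proof.
case: f g => f hf [g hg] /funext; rewrite /endo_fun /= => fg;
  case: g / fg in hg *.
by congr Endo; exact: Prop_irrelevance.
Qed.

HB.instance Definition _ := gen_eqMixin endo.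
HB.instance Definition _ := gen_choiceMixin endo.

Fact endo0_linear : linear (fun _ : Fock C => 0 : Fock C).
Proof. exact: linearP (\0 : {linear Fock C -> Fock C}). Qed.
Fact endo1_linear : linear (fun x : Fock C => x).
Proof. by []. Qed.
Fact endoN_linear (f : endo) : linear (fun x => - f x).
Proof. exact: linearP (\- f). Qed.
Fact endoD_linear (f g : endo) : linear (fun x => f x + g x).
Proof. exact: linearP (f \+ g). Qed.
Fact endoM_linear (f g : endo) : linear (fun x => f (g x)).
Proof. exact: linearP (f \o g). Qed.
Fact endoZ_linear a (f : endo) : linear (fun x => a *: f x).
Proof. exact: linearP (a \*: f). Qed.

Definition endo0 := Endo endo0_linear.
Definition endo1 := Endo endo1_linear.
Definition endoN f := Endo (endoN_linear f).
Definition endoD f g := Endo (endoD_linear f g).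
Definition endoM f g := Endo (endoM_linear f g).
Definition endoZ a f := Endo (endoZ_linear a f).

Fact endo_addA : associative endoD.
Proof. by move=> f g h; apply: endo_eq => x; exact: addrA. Qed.
Fact endo_addC : commutative endoD.
Proof. by move=> f g; apply: endo_eq => x; exact: addrC. Qed.
Fact endo_add0 : left_id endo0 endoD.
Proof. by move=> f; apply: endo_eq => x; exact: add0r. Qed.
Fact endo_addN : left_inverse endo0 endoN endoD.
Proof. by move=> f; apply: endo_eq => x; exact: addNr. Qed.
HB.instance Definition _ :=
  GRing.isZmodule.Build endo endo_addA endo_addC endo_add0 endo_addN.

Fact endo_mulA : associative endoM.
Proof. by move=> f g h; exact: endo_eq. Qed.
Fact endo_mul1 : left_id endo1 endoM.
Proof. by move=> f; exact: endo_eq. Qed.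
Fact endo_mulr1 : right_id endo1 endoM.
Proof. by move=> f; exact: endo_eq. Qed.
Fact endo_mulDl : left_distributive endoM +%R.
Proof. by move=> f g h; exact: endo_eq. Qed.
Fact endo_mulDr : right_distributive endoM +%R.
Proof. by move=> f g h; apply: endo_eq => x; exact: raddfD. Qed.
Fact vac_neq0 : vac != 0 :> Fock C.
Proof. by rewrite /vac /ket monalgU_eq0 oner_eq0. Qed.
Fact endo_oner_neq0 : endo1 != 0.
Proof.
apply/eqP=> /(congr1 (fun f : endo => f vac)); exact/eqP/vac_neq0.
Qed.
HB.instance Definition _ := GRing.Zmodule_isNzRing.Build endo
  endo_mulA endo_mul1 endo_mulr1 endo_mulDl endo_mulDr endo_oner_neq0.

Fact endo_scaleA a b f : endoZ a (endoZ b f) = endoZ (a * b) f.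
Proof. by apply: endo_eq => x; exact: scalerA. Qed.
Fact endo_scale1 : left_id 1 endoZ.
Proof. by move=> f; apply: endo_eq => x; exact: scale1r. Qed.
Fact endo_scaleDr : right_distributive endoZ +%R.
Proof. by move=> a f g; apply: endo_eq => x; exact: scalerDr. Qed.
Fact endo_scaleDl f : {morph endoZ^~ f : a b / a + b}.
Proof. by move=> a b; apply: endo_eq => x; exact: scalerDl. Qed.
HB.instance Definition _ := GRing.Zmodule_isLmodule.Build C endo
  endo_scaleA endo_scale1 endo_scaleDr endo_scaleDl.

Fact endo_scaleAl (a : C) (f g : endo) : a *: (f * g) = (a *: f) * g.
Proof. exact: endo_eq. Qed.
HB.instance Definition _ := GRing.Lmodule_isLalgebra.Build C endo endo_scaleAl.
Fact endo_scaleAr (a : C) (f g : endo) : a *: (f * g) = f * (a *: g).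
Proof. by apply: endo_eq => x; rewrite /= -[LHS]linearZ. Qed.
HB.instance Definition _ := GRing.Lalgebra_isAlgebra.Build C endo endo_scaleAr.

Lemma endoDE (f g : endo) x : (f + g) x = f x + g x. Proof. by []. Qed.
Lemma endoNE (f : endo) x : (- f) x = - f x. Proof. by []. Qed.
Lemma endoME (f g : endo) x : (f * g) x = f (g x). Proof. by []. Qed.
Lemma endo1E x : (1 : endo) x = x. Proof. by []. Qed.
Lemma endoZE a (f : endo) x : (a *: f) x = a *: f x. Proof. by []. Qed.
Lemma endo_sumE (I : Type) (r : seq I) (P : pred I) (F : I -> endo) x :
  (\sum_(i <- r | P i) F i) x = \sum_(i <- r | P i) F i x.
Proof. by elim/big_ind2: _ => // f y g z <- <-. Qed.

(** A sealed copy of the basis vectors: comparing two of them by conversion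
    would unfold the underlying finitely supported functions. *)
Fact basis_key : unit. Proof. exact: tt. Qed.
Definition basis : monomial -> Fock C := locked_with basis_key (@ket C).
Lemma basisE b : ket C b = basis b.
Proof. by rewrite /basis unlock. Qed.

Lemma endo_basis (f g : endo) : (forall b, f (basis b) = g (basis b)) -> f = g.
Proof.
move=> fg; apply: endo_eq => x; rewrite [x]ket_expand !linear_sum.
by apply: eq_bigr => b _; rewrite !linearZ /= basisE fg.
Qed.

Definition ext f : endo := Endo (linext_linear f).
End EndoRing.

(** * Canonical commutation and anticommutation relations *)

Section Generators.
Variable C : numClosedFieldType.
Implicit Types (i j : gen) (b : monomial).

(** Creation and annihilation operators, bosonic and fermionic, sealed for the
    same reason as the basis. *)
Fact gen_key : unit. Proof. exact: tt. Qed.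
Definition bC := locked_with gen_key (fun i => ext (fun b =>
  ket C ((i +` b.1)%mset, b.2))).
Definition bD := locked_with gen_key (fun i => ext (fun b =>
  (b.1 i)%:R *: ket C ((b.1 `\ i)%mset, b.2))).
Definition fC := locked_with gen_key (fun i => ext (fun b =>
  if i \in b.2 then 0 else fsign C i b.2 *: ket C (b.1, (i |` b.2)%fset))).
Definition fD := locked_with gen_key (fun i => ext (fun b =>
  if i \in b.2 then fsign C i b.2 *: ket C (b.1, (b.2 `\ i)%fset) else 0)).

Lemma bcreateE i : bcreate i =1 bC i.
Proof. by move=> x; rewrite /bC unlock. Qed.
Lemma bderivE i : bderiv i =1 bD i.
Proof. by move=> x; rewrite /bD unlock. Qed.
Lemma fcreateE i : fcreate i =1 fC i.
Proof. by move=> x; rewrite /fC unlock. Qed.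
Lemma fderivE i : fderiv i =1 fD i.
Proof. by move=> x; rewrite /fD unlock. Qed.

Lemma bC_basis i b : bC i (basis C b) = basis C ((i +` b.1)%mset, b.2).
Proof. by rewrite -bcreateE -basisE [LHS]linext_ket ?basisE. Qed.
Lemma bD_basis i b :
  bD i (basis C b) = (b.1 i)%:R *: basis C ((b.1 `\ i)%mset, b.2).
Proof. by rewrite -bderivE -basisE [LHS]linext_ket ?basisE. Qed.
Lemma fC_basis i b : fC i (basis C b) =
  if i \in b.2 then 0 else fsign C i b.2 *: basis C (b.1, (i |` b.2)%fset).
Proof. by rewrite -fcreateE -basisE [LHS]linext_ket ?basisE. Qed.
Lemma fD_basis i b : fD i (basis C b) =
  if i \in b.2 then fsign C i b.2 *: basis C (b.1, (b.2 `\ i)%fset) else 0.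
Proof. by rewrite -fderivE -basisE [LHS]linext_ket ?basisE. Qed.

Lemma endo_if (f : endo C) (t : bool) x y :
  f (if t then x else y) = if t then f x else f y.
Proof. by case: t. Qed.

Lemma endoZr (f : endo C) a x : f (a *: x) = a *: f x.
Proof. exact: linearZ. Qed.
Lemma endo0r (f : endo C) : f 0 = 0.
Proof. exact: linear0. Qed.
Lemma bC_bC i j : bC i * bC j = bC j * bC i.
Proof.
apply: endo_basis => b; rewrite !endoME !bC_basis /=; congr (basis C (_, _)).
by rewrite msetDCA.
Qed.

Lemma bD_bC i j : bD i * bC j = bC j * bD i + (i == j)%:R.
Proof.
apply: endo_basis => -[A B]; rewrite endoDE !endoME bC_basis !bD_basis endoZr
  bC_basis /=.
rewrite mset1DE; have [-> | ij] := eqVneq i j.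
  rewrite endo1E msetD1K natrD scalerDl scale1r addrC.
  have [->|Aj] := posnP (A j); first by rewrite !scale0r.
  by rewrite msetB1K // in_mset.
rewrite add0n addr0.
have [->|Ai] := posnP (A i); first by rewrite !scale0r.
congr (_ *: basis C (_, _)); apply/msetP => k; rewrite !(mset1DE, msetB1E).
have ki : ((k == i) <= A k)%N by case: eqVneq => // ->.
by rewrite addnBA.
Qed.

Lemma bC_fC i j : bC i * fC j = fC j * bC i.
Proof.
by apply: endo_basis => b; rewrite !endoME bC_basis !fC_basis endo_if endo0r
  endoZr bC_basis.
Qed.
Lemma bC_fD i j : bC i * fD j = fD j * bC i.
Proof.
by apply: endo_basis => b; rewrite !endoME bC_basis !fD_basis endo_if endo0r
  endoZr bC_basis.
Qed.
Lemma bD_fC i j : bD i * fC j = fC j * bD i.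
Proof.
apply: endo_basis => b; rewrite !endoME bD_basis endoZr !fC_basis endo_if
  endo0r endoZr.
rewrite bD_basis /=; case: ifP => _; first by rewrite !scaler0.
by rewrite !scalerA mulrC.
Qed.

Lemma bD_fD i j : bD i * fD j = fD j * bD i.
Proof.
apply: endo_basis => b; rewrite !endoME bD_basis endoZr !fD_basis endo_if
  endo0r endoZr.
rewrite bD_basis /=; case: ifP => _; last by rewrite scaler0.
by rewrite !scalerA mulrC.
Qed.

Lemma bD_vac i : bD i vac = 0.
Proof. by rewrite /vac basisE bD_basis /= mset0E scale0r. Qed.
Lemma fD_vac i : fD i vac = 0.
Proof. by rewrite /vac basisE fD_basis. Qed.

Lemma fcode_inj : injective fcode.
Proof. by move=> [a m] [b n]; rewrite /fcode /= => h; congr (_, _); lia. Qed.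

(** Adding [j] changes the sign attached to [i] exactly when [j] precedes [i];
    the anticommutation relations follow since, for [i != j], exactly one of [i]
    and [j] precedes the other. *)
Fact fsign_add i j (B : {fset gen}) : j \notin B ->
  fsign C i (j |` B)%fset = (-1) ^+ (fcode j < fcode i)%N * fsign C i B.
Proof.
move=> jB; rewrite /fsign -exprD; congr (_ ^+ _).
have -> : [fset k in (j |` B)%fset | (fcode k < fcode i)%N]%fset
   = if (fcode j < fcode i)%N
     then (j |` [fset k in B | (fcode k < fcode i)%N])%fset
     else [fset k in B | (fcode k < fcode i)%N]%fset.
  apply/fsetP => k; case: ifP => ji; rewrite !inE /=.
    by case: eqVneq => //= ->; rewrite ji.
  by case: eqVneq => //= ->; rewrite ji andbF.
by case: ifP => // _; rewrite cardfsU1 !inE (negPf jB).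
Qed.

Fact fsign_sq i (B : {fset gen}) : fsign C i B * fsign C i B = 1.
Proof. by rewrite -expr2 sqrr_sign. Qed.

Fact fsign_rem i j (B : {fset gen}) : j \in B ->
  fsign C i (B `\ j)%fset = (-1) ^+ (fcode j < fcode i)%N * fsign C i B.
Proof.
move=> jB; rewrite -{2}(fsetD1K jB) fsign_add ?inE ?eqxx //.
by rewrite mulrA -expr2 sqrr_sign mul1r.
Qed.

Fact fsign_swap i j : i != j ->
  (-1) ^+ (fcode j < fcode i)%N = - (-1) ^+ (fcode i < fcode j)%N :> C.
Proof.
move=> ij; case: (ltngtP (fcode j)) => [||/fcode_inj ji]; rewrite ?opprK //.
by rewrite ji eqxx in ij.
Qed.

Lemma fC_fC i j : fC i * fC j = - (fC j * fC i).
Proof.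
apply: endo_basis => -[A B]; rewrite endoNE !endoME !fC_basis !endo_if !endo0r
  !endoZr.
rewrite !fC_basis /= !inE; have [-> | ij] := eqVneq i j.
  by rewrite /= scaler0; case: ifP; rewrite oppr0.
rewrite /=.
case jB: (j \in B); case iB: (i \in B).
- by rewrite oppr0.
- by rewrite scaler0 oppr0.
- by rewrite scaler0 oppr0.
rewrite !fsign_add ?iB ?jB // !scalerA -scaleNr (fsign_swap ij) fsetUCA.
by congr (_ *: _); ring.
Qed.

Lemma fD_fD i j : fD i * fD j = - (fD j * fD i).
Proof.
apply: endo_basis => -[A B]; rewrite endoNE !endoME !fD_basis !endo_if !endo0r
  !endoZr.
rewrite !fD_basis /= !inE; have [-> | ij] := eqVneq i j.
  by rewrite /= scaler0; case: ifP; rewrite oppr0.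
rewrite /=.
case jB: (j \in B); case iB: (i \in B); last first.
- by rewrite oppr0.
- by rewrite scaler0 oppr0.
- by rewrite scaler0 oppr0.
rewrite !fsign_rem ?iB ?jB // !scalerA -scaleNr (fsign_swap ij).
rewrite (_ : ((B `\ j) `\ i)%fset = ((B `\ i) `\ j)%fset); last first.
  by apply/fsetP => k; rewrite !inE andbCA.
by congr (_ *: _); ring.
Qed.

Lemma fD_fC i j : fD i * fC j = - (fC j * fD i) + (i == j)%:R.
Proof.
apply: endo_basis => -[A B]; rewrite endoDE endoNE !endoME fC_basis fD_basis.
rewrite !endo_if !endo0r !endoZr fC_basis fD_basis /= !inE.
have [-> | ij] := eqVneq i j.
  rewrite endo1E /=; case: ifP => jB.
    by rewrite fsign_rem // ltnn mul1r scalerA fsign_sq scale1r fsetD1K //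
      addNr.
  by rewrite oppr0 add0r fsign_add ?jB // ltnn mul1r scalerA fsign_sq scale1r
    fsetU1K // jB.
rewrite addr0 /=.
case jB: (j \in B); case iB: (i \in B); last by rewrite scaler0 oppr0.
- by rewrite scaler0 oppr0.
- by rewrite oppr0.
rewrite fsign_add ?jB // fsign_rem // !scalerA -scaleNr (fsign_swap ij).
rewrite (_ : ((j |` B) `\ i)%fset = (j |` (B `\ i))%fset); last first.
  apply/fsetP => k; rewrite !inE; case: (eqVneq k j) => [->|]; last by [].
  by rewrite eq_sym ij.
by congr (_ *: _); ring.
Qed.
End Generators.

(** * Locally finite sums of operators *)

Section LocallyFinite.
Variable C : numClosedFieldType.
Implicit Types (b : monomial) (x : Fock C) (T : nat -> endo C).

Definition bounded K x :=
  forall i : gen, (K <= i.2)%N -> bD C i x = 0 /\ fD C i x = 0.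

Definition kbound b : nat :=
  (\max_(i <- finsupp (b.1 : {mset gen}%mset)) i.2
   + \max_(i <- (b.2 : {fset gen})) i.2).+1.

Lemma kboundP b : bounded (kbound b) (basis C b).
Proof.
move=> i Ki; rewrite bD_basis fD_basis.
have ib1 : b.1 i = 0%N.
  apply/eqP; rewrite -[_ == _]negbK -mem_finsupp; apply/negP => ib.
  move: Ki; rewrite leqNgt => /negP; apply; rewrite ltnS.
  by apply: leq_trans (leq_addr _ _); rewrite (big_rem i ib) leq_maxl.
have ib2 : i \notin b.2.
  apply/negP => ib; move: Ki; rewrite leqNgt => /negP; apply; rewrite ltnS.
  by apply: leq_trans (leq_addl _ _); rewrite (big_rem i ib) leq_maxl.
by rewrite (negPf ib2) ib1 scale0r.
Qed.

(** The sum of all [T k].  On a basis vector [b] the terms with [k >= kbound b]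
    vanish when [T] is locally finite, so that a finite sum, depending on [b],
    suffices. *)
Definition lsum := locked_with gen_key (fun T : nat -> endo C =>
  ext (fun b => \sum_(k < kbound b) T k (basis C b))).

Lemma lsum_basis T b : lsum T (basis C b) = \sum_(k < kbound b) T k (basis C b).
Proof. by rewrite /lsum unlock -{1}basisE [LHS]linext_ket. Qed.

Definition locally_finite T :=
  forall K x, bounded K x -> forall k, (K <= k)%N -> T k x = 0.

Lemma lsumE T x : locally_finite T ->
  exists K0, forall K, (K0 <= K)%N -> lsum T x = \sum_(k < K) T k x.
Proof.
move=> Tfin; exists (\max_(b <- msupp x) kbound b) => K xK.
have -> : x = \sum_(b <- msupp x) x@_b *: basis C b.
  by rewrite {1}[x]ket_expand; apply: eq_bigr => b _; rewrite basisE.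
rewrite linear_sum.
under [RHS]eq_bigr do rewrite linear_sum.
rewrite exchange_big /=; apply: eq_big_seq => b bx.
rewrite linearZ /= lsum_basis.
under [RHS]eq_bigr do rewrite linearZ /=.
rewrite -scaler_sumr; congr (_ *: _).
have bK : (kbound b <= K)%N by apply: leq_trans xK; exact: leq_bigmax_seq.
rewrite (big_ord_widen K (fun k => T k (basis C b))) //
  [RHS](bigID (fun k : 'I_K => (k < kbound b)%N)) /=.
rewrite [X in _ + X]big1 ?addr0 // => k; rewrite -leqNgt.
by apply: Tfin; exact: kboundP.
Qed.

(** Supercommutators with a locally finite sum can be computed termwise; at most
    one term, that of index [k0], contributes. *)
Lemma lsum_comm T y k0 z (s : C) : locally_finite T ->
  (forall k, T k * y = s *: (y * T k) + (if k == k0 then z else 0)) ->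
  lsum T * y = s *: (y * lsum T) + z.
Proof.
move=> Tfin Ty; apply: endo_eq => x.
have [K1 lsum1] := lsumE x Tfin; have [K2 lsum2] := lsumE (y x) Tfin.
pose K := maxn K1 (maxn K2 k0.+1).
rewrite endoDE endoZE !endoME (lsum1 K) ?leq_maxl // (lsum2 K); last first.
  by rewrite leq_max leq_maxl orbT.
have -> : z x = \sum_(k < K) (if k == k0 :> nat then z else 0) x.
  have k0K : (k0 < K)%N by rewrite !leq_max leqnn !orbT.
  rewrite (bigD1 (Ordinal k0K)) //= eqxx big1 ?addr0 // => k.
  by rewrite -val_eqE /= => /negPf ->.
rewrite linear_sum scaler_sumr -big_split; apply: eq_bigr => k _ /=.
by rewrite -endoME Ty.
Qed.

Lemma lsum_comm0 T y (s : C) : locally_finite T ->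
  (forall k, T k * y = s *: (y * T k)) -> lsum T * y = s *: (y * lsum T).
Proof.
move=> Tfin Ty; rewrite -[RHS]addr0; apply: (lsum_comm (k0 := 0)) => // k.
by rewrite if_same addr0.
Qed.

Lemma locally_finite_mulD (a : nat -> C) (f : nat -> endo C)
    (d : gen -> endo C) e n :
  d = @bD C \/ d = @fD C ->
  locally_finite (fun k => a k *: (f k * d (e, n + k)%N)).
Proof.
move=> hd K x xK k Kk; rewrite endoZE endoME.
have [bx fx] := xK (e, n + k)%N (leq_trans Kk (leq_addl _ _)).
by case: hd => ->; rewrite ?bx ?fx linear0 scaler0.
Qed.
End LocallyFinite.

(** * The derivations attached to the modes of G and L *)

Section ModesOnCreation.
Variable C : numClosedFieldType.

(** The exponent [sum c(-k) z^k / (2k)] of the creation half of the vertex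
    operator of [e^(c/2)]; twice this series is the one of [e^c]. *)
Definition useries : pseries (endo C) :=
  fun k => if k is j.+1 then k.*2%:R^-1 *: bC C (false, j) else 0.
Definition psiseries : pseries (endo C) := fun m => fC C (false, m).

Lemma useries_comm i j : GRing.comm (useries i) (useries j).
Proof.
case: i j => [|i] [|j]; rewrite /GRing.comm /= ?mulr0 ?mul0r //.
by rewrite -!scalerAl -!scalerAr bC_bC !scalerA mulrC.
Qed.
Lemma useries_psi i j : GRing.comm (useries i) (psiseries j).
Proof.
case: i => [|i]; rewrite /GRing.comm /= ?mulr0 ?mul0r //.
by rewrite -!scalerAl -!scalerAr bC_fC.
Qed.

Lemma psiseries_anti i j :
  psiseries i * psiseries j = - (psiseries j * psiseries i).
Proof. exact: fC_fC. Qed.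

Section Bilinear.
Variables (a : nat -> C) (n : nat).

(** The vector field [sum_k a_k c(-k-1) d/dPsi^-(-n-k-1/2)] and its three
    analogues, which exchange the two kinds of generators or preserve them. *)
Definition cdpsi : endo C :=
  lsum (fun k => a k *: (bC C (false, k) * fD C (false, n + k)%N)).
Definition psidc : endo C :=
  lsum (fun k => a k *: (fC C (false, k) * bD C (false, n + k)%N)).
Definition cdc : endo C :=
  lsum (fun k => a k *: (bC C (false, k) * bD C (false, n + k)%N)).
Definition psidpsi : endo C :=
  lsum (fun k => a k *: (fC C (false, k) * fD C (false, n + k)%N)).

Let fin f d := @locally_finite_mulD C a f d false n.

Fact eq_mode k m : ((false, n + k)%N == (false, m) :> gen) = (n + k == m)%N.
Proof. by []. Qed.

(** The common form of the nonzero brackets below: the index [k] with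
    [n + k = m] is the only one whose annihilation operator meets the creation
    operator of index [m]. *)
Fact mode_term (s t : C) (T : nat -> endo C) (y : endo C)
    (f : nat -> endo C) m :
  locally_finite T ->
  (forall k, T k * y = s *: (y * T k)
     + (if (n + k == m)%N then t *: (a k *: f k) else 0)) ->
  lsum T * y = s *: (y * lsum T) +
    (if (n <= m)%N then t *: (a (m - n)%N *: f (m - n)%N) else 0).
Proof.
move=> Tfin Ty; case: leqP => nm; last first.
  rewrite addr0; apply: lsum_comm0 => // k; rewrite Ty.
  by case: eqP => [|_]; [lia | rewrite addr0].
apply: (@lsum_comm _ _ _ (m - n)%N) => // k; rewrite Ty; congr (_ + _).
have -> : (k == m - n)%N = (n + k == m)%N by apply/eqP/eqP; lia.
by case: eqP => // <-; rewrite addKn.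
Qed.

Lemma cdpsi_c m : cdpsi * bC C (false, m) = bC C (false, m) * cdpsi.
Proof.
rewrite -[RHS]scale1r; apply: lsum_comm0 => [|k]; first by apply: fin; right.
by rewrite scale1r -scalerAl -scalerAr -mulrA -bC_fD !mulrA bC_bC.
Qed.

Lemma cdpsi_psi m : cdpsi * fC C (false, m) = - (fC C (false, m) * cdpsi) +
  (if (n <= m)%N then a (m - n)%N *: bC C (false, m - n)%N else 0).
Proof.
rewrite -scaleN1r -[a _ *: _]scale1r.
apply: (mode_term (f := fun k => bC C (false, k))) => [|k];
  first by apply: fin; right.
rewrite scaleN1r -scalerAl -scalerAr -mulrA fD_fC eq_mode mulrDr mulrN mulrA
  bC_fC.
rewrite -mulrA scalerDr scalerN; congr (_ + _).
by case: ifP => _; rewrite ?mulr1 ?scale1r // mulr0 scaler0.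
Qed.

Lemma psidc_c m : psidc * bC C (false, m) = bC C (false, m) * psidc +
  (if (n <= m)%N then a (m - n)%N *: fC C (false, m - n)%N else 0).
Proof.
rewrite -[bC _ _ * _]scale1r -[a _ *: _]scale1r.
apply: (mode_term (f := fun k => fC C (false, k))) => [|k];
  first by apply: fin; left.
rewrite !scale1r -scalerAl -scalerAr -mulrA bD_bC eq_mode mulrDr !mulrA -bC_fC.
rewrite scalerDr; congr (_ + _).
by case: ifP => _; rewrite ?mulr1 ?scale1r // mulr0 scaler0.
Qed.

Lemma psidc_psi m : psidc * fC C (false, m) = - (fC C (false, m) * psidc).
Proof.
rewrite -scaleN1r; apply: lsum_comm0 => [|k]; first by apply: fin; left.
by rewrite scaleN1r -scalerAl -scalerAr -mulrA bD_fC !mulrA fC_fC mulNr scalerN.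
Qed.

Lemma cdc_c m : cdc * bC C (false, m) = bC C (false, m) * cdc +
  (if (n <= m)%N then a (m - n)%N *: bC C (false, m - n)%N else 0).
Proof.
rewrite -[bC _ _ * _]scale1r -[a _ *: _]scale1r.
apply: (mode_term (f := fun k => bC C (false, k))) => [|k];
  first by apply: fin; left.
rewrite !scale1r -scalerAl -scalerAr -mulrA bD_bC eq_mode mulrDr !mulrA bC_bC.
rewrite scalerDr; congr (_ + _).
by case: ifP => _; rewrite ?mulr1 ?scale1r // mulr0 scaler0.
Qed.

Lemma cdc_psi m : cdc * fC C (false, m) = fC C (false, m) * cdc.
Proof.
rewrite -[RHS]scale1r; apply: lsum_comm0 => [|k]; first by apply: fin; left.
by rewrite scale1r -scalerAl -scalerAr -mulrA bD_fC !mulrA bC_fC.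
Qed.

Lemma psidpsi_c m : psidpsi * bC C (false, m) = bC C (false, m) * psidpsi.
Proof.
rewrite -[RHS]scale1r; apply: lsum_comm0 => [|k]; first by apply: fin; right.
by rewrite scale1r -scalerAl -scalerAr -mulrA -bC_fD !mulrA bC_fC.
Qed.

Lemma psidpsi_psi m : psidpsi * fC C (false, m) = fC C (false, m) * psidpsi +
  (if (n <= m)%N then a (m - n)%N *: fC C (false, m - n)%N else 0).
Proof.
rewrite -[fC _ _ * _]scale1r -[a _ *: _]scale1r.
apply: (mode_term (f := fun k => fC C (false, k))) => [|k];
  first by apply: fin; right.
rewrite !scale1r -scalerAl -scalerAr -mulrA fD_fC eq_mode mulrDr mulrN !mulrA
  fC_fC.
rewrite mulNr opprK scalerDr; congr (_ + _).
by case: ifP => _; rewrite ?mulr1 ?scale1r // mulr0 scaler0.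
Qed.
End Bilinear.

Fact cancel_even (V : zmodType) (a b d z : V) :
  a + (b + z) + d - (a + b + d) = z.
Proof. by rewrite addrA [X in X - _]addrAC [X in X - _]addrC addrK. Qed.

Fact cancel_even2 (V : zmodType) (a b d w z : V) :
  a + z + b + (d + w) - (a + b + d) = z + w.
Proof.
rewrite [X in X - _](AC (3*2) ((2*5)*((1*3)*4))) /=.
by rewrite addrK.
Qed.

Fact cancel_odd (V : zmodType) (a b d x y : V) :
  - a + x - b + (- d + y) + (a + b + d) = x + y.
Proof.
rewrite [X in X + _](AC (3*2) ((2*5)*((1*3)*4))) /=.
by rewrite -!opprD subrK.
Qed.

Variable q : nat.

(** What [G(n+1/2) / sqrt 2] becomes on vectors built from [c(-k)] and
    [Psi^-(-k-1/2)] only; on the whole Fock space it is still an endomorphism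
    with the right brackets. *)
Definition Gder n : endo C :=
  cdpsi (fun=> 2^-1) n.+1 + psidc (fun k => (n + k).+1%:R) n
  + (n%:R - q%:R + 2^-1) *: fD C (false, n).

Fact double_inv k : k.+1.*2%:R^-1 * k.+1%:R = 2^-1 :> C.
Proof.
by rewrite -muln2 natrM invfM mulrAC mulVf ?mul1r // pnatr_eq0.
Qed.

Lemma GderP n : odd_der useries psiseries (Gder n) n (n%:R - q%:R + 2^-1).
Proof.
split=> [[|k]|m].
- by rewrite mulr0 mul0r subr0.
- rewrite -scalerAr -scalerAl -scalerBr /Gder 2!mulrDl 2!mulrDr.
  rewrite cdpsi_c psidc_c -!scalerAl -!scalerAr bC_fD cancel_even /= subSS ltnS.
  case: leqP => nk; last by rewrite scaler0.
  rewrite subnKC // scalerA /psiseries; congr (_ *: _).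
  exact: double_inv.
- rewrite /Gder 2!mulrDl 2!mulrDr cdpsi_psi psidc_psi -!scalerAl -!scalerAr
  fD_fC.
  rewrite scalerDr scalerN cancel_odd; congr (_ + _); last first.
    have -> : ((false, n) == (false, m) :> gen) = (m == n) by rewrite
      [RHS]eq_sym.
    by case: eqP => _; rewrite ?mul1r // mul0r scaler0 scale0r.
  case: ltngtP => nm //; last by rewrite nm subnn mulr0n.
  rewrite -(subnSK nm) /= -scaler_nat scalerA; congr (_ *: _).
  by rewrite mulrC double_inv.
Qed.

(** Similarly for [L(N)], [N > 0]; [even_shift] collects the contributions of
    [c(0)] and of the derivative of [d(z)] to the coefficient of [d/dc(-N)]. *)
Definition even_shift N : C := N%:R * (N%:R - q.*2%:R).
Definition Lder N : endo C :=
  cdc (fun k => (N + k).+1%:R) N + psidpsi (fun m => m%:R + (N%:R + 1) / 2) N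
  + even_shift N *: bD C (false, N.-1).

Lemma LderP N : (0 < N)%N -> even_der useries psiseries q (Lder N) N.
Proof.
case: N => // n _; split=> [[|k]|m].
- by rewrite mulr0 mul0r subr0 /= mul0r scale0r addr0.
- rewrite -scalerAr -scalerAl -scalerBr /Lder 2!mulrDl 2!mulrDr.
  rewrite cdc_c psidpsi_c -!scalerAl -!scalerAr bD_bC.
  rewrite [even_shift _ *: (_ + _)]scalerDr cancel_even2 scalerDr.
  congr (_ + _).
    rewrite ltnS subSS; case: ltngtP => nk; rewrite ?scaler0 //; last first.
      by rewrite nk subnn mulr0n.
    rewrite -(subnSK nk) /= -scaler_nat !scalerA.
    by rewrite subnKC // double_inv mulrC double_inv.
  have -> : ((false, n) == (false, k) :> gen) = (k == n) by rewrite [RHS]eq_sym.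
  rewrite eqSS; case: eqP => [->|_]; last by rewrite mul0r !scaler0 scale0r.
  rewrite mul1r scalerA; congr (_ *: _).
  by rewrite /even_shift mulrA double_inv mulrBr -muln2 natrM; field.
- rewrite /Lder 2!mulrDl 2!mulrDr cdc_psi psidpsi_psi -!scalerAl -!scalerAr
  bD_fC.
  by rewrite cancel_even.
Qed.
End ModesOnCreation.

(** * The modes of omega and tau on the half Fock space *)

Section Modes.
Variable C : numClosedFieldType.
Implicit Types (x : Fock C).

Lemma endoNr (f : endo C) x : f (- x) = - f x.
Proof. exact: linearN. Qed.

Fact half_regroup (V : lmodType C) (y z t : V) (a b : C) :
  (1 / 2) *: (2 *: y - a *: t) + (1 / 2) *: (2 *: z) + b *: t
  = y + z + (b - a / 2) *: t.
Proof.
have half (v : V) : (1 / 2) *: (2 *: v) = v.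
  by rewrite scalerA mul1r mulVf ?scale1r // pnatr_eq0.
rewrite scalerBr !half scalerA scalerBl (_ : 1 / 2 * a = a / 2); last by field.
by rewrite (addrAC y) -[LHS]addrA (addrC (b *: t)).
Qed.

Lemma ex_bounded x : exists K, bounded K x.
Proof.
exists (\max_(b <- msupp x) kbound b) => i Ki.
have -> : x = \sum_(b <- msupp x) x@_b *: basis C b.
  by rewrite {1}[x]ket_expand; apply: eq_bigr => b _; rewrite basisE.
have b0 b : b \in msupp x -> bD C i (basis C b) = 0 /\ fD C i (basis C b) = 0.
  by move=> bx; apply: (@kboundP C b i); apply: leq_trans Ki;
    exact: leq_bigmax_seq.
rewrite !linear_sum; split; rewrite big_seq big1 // => b /b0[d1 d2].
  by rewrite linearZ /= d1 scaler0.
by rewrite linearZ /= d2 scaler0.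
Qed.

Lemma lsum_bounded T K x : locally_finite T -> bounded K x ->
  lsum T x = \sum_(k < K) T k x.
Proof.
move=> Tfin xK; have [K0 lsumT] := lsumE x Tfin.
rewrite (lsumT (maxn K0 K)) ?leq_maxl //.
rewrite [RHS](big_ord_widen (maxn K0 K) (fun k => T k x)) ?leq_maxr //.
rewrite [LHS](bigID (fun k : 'I__ => (k < K)%N)) /=.
rewrite [X in _ + X]big1 ?addr0 // => k; rewrite -leqNgt => Kk.
exact: (Tfin K).
Qed.

(** All the sums over infinite index sets reduce to finite ones through an
    injective parametrisation [h] of the indices that contribute. *)
Lemma fsum_nat (I : choiceType) (A : set I) (h : nat -> I) K (F : I -> Fock C) :
  injective h -> (forall j, (j < K)%N -> A (h j)) ->
  (forall i, A i -> F i = 0 \/ exists2 j, (j < K)%N & i = h j) ->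
  \sum_(i \in A) F i = \sum_(j < K) F (h j).
Proof.
move=> hinj hA hF; rewrite (fsbigE (map h (iota 0 K))).
- rewrite big_map -(big_mkord xpredT (fun j => F (h j))).
  rewrite /index_iota subn0 big_seq_cond [RHS]big_seq; apply: eq_bigl => j.
  rewrite mem_iota add0n /=; case: ltnP => //= jK.
  by rewrite mem_set //; exact: hA.
- by rewrite map_inj_uniq ?iota_uniq.
- by move=> i /= /mapP[j]; rewrite mem_iota => jK ->; exact: hA.
- move=> i Ai; case: (hF i Ai) => // -[j jK ->] /negP[].
  by rewrite map_f // mem_iota.
Qed.

Definition psi_op (e : bool) (n : int) : endo C :=
  match n with Negz k => fC C (e, k) | Posz k => fD C (~~ e, k) end.
Lemma psiE e n : psi e n =1 psi_op e n.
Proof. by case: n => k x /=; rewrite ?fcreateE ?fderivE. Qed.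

Definition heis_op (w h : hh C) (n : int) : endo C :=
  match n with
  | Negz k => h.1 *: bC C (false, k) + h.2 *: bC C (true, k)
  | Posz 0 => (Defs.form h w)%:A
  | Posz k.+1 => k.+1%:R *: (Defs.form h (cc C) *: bD C (false, k)
                             + Defs.form h (dd C) *: bD C (true, k))
  end.
Lemma heisE w h n : heis w h n =1 heis_op w h n.
Proof. by case: n => [[|k]|k] x /=; rewrite ?bcreateE ?bderivE. Qed.

Lemma heis_ccN w j x : heis w (cc C) (Negz j) x = bC C (false, j) x.
Proof. by rewrite /= scale1r scale0r addr0 bcreateE. Qed.
Lemma form_cc : Defs.form (cc C) (cc C) = 0.
Proof. by rewrite /Defs.form /=; ring. Qed.
Lemma form_cd : Defs.form (cc C) (dd C) = 2.
Proof. by rewrite /Defs.form /=; ring. Qed.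
Lemma form_dc : Defs.form (dd C) (cc C) = 2.
Proof. by rewrite /Defs.form /=; ring. Qed.
Lemma form_dd : Defs.form (dd C) (dd C) = 0.
Proof. by rewrite /Defs.form /=; ring. Qed.

Lemma heis_ddP w j x :
  heis w (dd C) (Posz j.+1) x = (2 * j.+1%:R) *: bD C (false, j) x.
Proof.
by rewrite /heis form_dc form_dd scale0r addr0 bderivE scalerA mulrC.
Qed.
Lemma heis_ccP w j x :
  heis w (cc C) (Posz j.+1) x = (2 * j.+1%:R) *: bD C (true, j) x.
Proof.
by rewrite /heis form_cc form_cd scale0r add0r bderivE scalerA mulrC.
Qed.

(** The vectors built from the vacuum with [c(-n)] and [Psi^-(-n-1/2)] only,
    characterised as those annihilated by the derivatives with respect to the
    other generators [d(-n)] and [Psi^+(-n-1/2)]. *)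
Definition halfFock x := forall k, bD C (true, k) x = 0 /\ fD C (true, k) x = 0.

Variables (cL r : C) (q : nat).
Let w := wt cL q.*2%:R r.

Fact double1_natr : q.*2.+1%:R = q%:R * 2 + 1 :> C.
Proof. by rewrite -addn1 natrD -muln2 natrM. Qed.

Lemma wt_snd : w.2 = - (q%:R + 2^-1).
Proof.
rewrite /w /wt /dbar /dd /cc /= !scaler0 subr0 addr0 -[LHS]/(_ * 1) natr1.
by rewrite double1_natr; field.
Qed.

Section OnHalfFock.
Variable x : Fock C.
Hypothesis xhalf : halfFock x.

Lemma heis_cc0 : heis w (cc C) 0 x = - q.*2.+1%:R *: x.
Proof.
by rewrite /heis /Defs.form wt_snd double1_natr /=; congr (_ *: _); field.
Qed.

Fact idxN n j : n%:Z + 1 - 1 - Negz j = (n.+1 + j)%N.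
Proof. lia. Qed.

(** In the normally ordered products below one of the two halves reduces to at
    most its zero mode term, because the positive modes of [c] and [Psi^-]
    vanish on [x]. *)
Lemma nprod_cc_psi K n : bounded K x ->
  nprod false (heis w (cc C)) (psi true) (n%:Z + 1) x =
  \sum_(j < K) bC C (false, j : nat) (fD C (false, n.+1 + j)%N x)
  - q.*2.+1%:R *: fD C (false, n) x.
Proof.
move=> xK; rewrite /nprod expr0 scale1r; congr (_ + _).
  have -> : \sum_(j < K) bC C (false, j : nat) (fD C (false, (n.+1 + j)%N) x) =
     \sum_(j < K) (fun k => heis w (cc C) k (psi true (n%:Z + 1 - 1 - k) x))
       (Negz j).
    apply: eq_bigr => j _; rewrite heis_ccN idxN.
    by rewrite psiE.
  apply: fsum_nat => //; first by move=> i j [].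
  case=> // j _; have [jK|Kj] := ltnP j K; first by right; exists j.
  left; rewrite heis_ccN idxN.
  have Knj : (K <= n.+1 + j)%N := leq_trans Kj (leq_addl _ _).
  by have [_ fx] := xK (false, n.+1 + j)%N Knj; rewrite psiE /= fx linear0.
rewrite (@fsum_nat _ _ Posz 1).
- rewrite big_ord1 subr0 addrK heis_cc0 psiE.
  by rewrite endoZr scaleNr.
- by move=> i j [].
- by [].
case=> // -[|j] _; first by right; exists 0%N.
by left; rewrite heis_ccP (xhalf j).1 scaler0 psiE linear0.
Qed.

Lemma psi_false0 n : psi false (Posz n) x = 0.
Proof. by rewrite psiE /= (xhalf n).2. Qed.
Lemma psi_false_bD n i : psi false (Posz n) (bD C i x) = 0.
Proof. by rewrite psiE /= -endoME -bD_fD endoME (xhalf n).2 linear0. Qed.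
Lemma psi_false_fD n i : psi false (Posz n) (fD C i x) = 0.
Proof. by rewrite psiE /= -endoME fD_fD endoNE endoME (xhalf n).2 linear0
  oppr0. Qed.

Lemma nprod_dd_psi K n : bounded K x ->
  nprod false (heis w (dd C)) (psi false) (n%:Z + 1) x =
  \sum_(j < K) (2 * (n + j).+1%:R) *: fC C (false, j : nat) (bD C (false, n +
    j)%N x).
Proof.
move=> xK; rewrite /nprod expr0 scale1r fsbig1 ?add0r; last first.
  by case=> // j _; rewrite idxN psi_false0 heisE linear0.
have idxP j : n%:Z + 1 - 1 - (n + j).+1%:Z = Negz j by rewrite NegzE; lia.
(* The modes [d(k)] with [k <= n] are followed by an annihilating [Psi^-]. *)
rewrite (@fsum_nat _ _ (fun j => Posz (n + j).+1) K).
- apply: eq_bigr => j _.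
  by rewrite idxP heis_ddP psiE endoZr.
- by move=> i j []; lia.
- by [].
case=> // -[|i] _.
  left; rewrite subr0 addrK psiE heisE /= linearZ /= (xhalf n).2 scaler0 //.
have [ni|ni] := leqP n i; last first.
  left; rewrite heis_ddP (_ : _ - _ = Posz (n - i.+1)); last by lia.
  by rewrite psiE endoZr -psiE psi_false_bD scaler0.
have [iK|Ki] := ltnP (i - n) K; first by right; exists (i - n)%N;
  rewrite ?subnKC.
have Ki' : (K <= i)%N := leq_trans Ki (leq_subr _ _).
by left; rewrite heis_ddP (xK (false, i) Ki').1 scaler0 psiE linear0.
Qed.

Lemma nprod_cc_dd K n : bounded K x ->
  nprod false (heis w (cc C)) (heis w (dd C)) (n.+1%:Z + 1) x =
  \sum_(j < K) (2 * (n.+1 + j).+1%:R) *: bC C (false, j : nat) (bD C (false,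
    n.+1 + j)%N x)
  - (q.*2.+1%:R * (2 * n.+1%:R)) *: bD C (false, n) x.
Proof.
move=> xK; rewrite /nprod expr0 scale1r; congr (_ + _).
  rewrite (@fsum_nat _ _ Negz K).
  - apply: eq_bigr => j _.
    by rewrite idxN heis_ccN heis_ddP endoZr.
  - by move=> i j [].
  - by [].
  case=> // j _; have [jK|Kj] := ltnP j K; first by right; exists j.
  have Knj : (K <= n.+1 + j)%N := leq_trans Kj (leq_addl _ _).
  by left; rewrite heis_ccN idxN heis_ddP (xK (false, n.+1 + j)%N Knj).1
    scaler0 linear0.
rewrite (@fsum_nat _ _ Posz 1).
- rewrite big_ord1 subr0 addrK heis_cc0 heisE endoZr -heisE heis_ddP.
  by rewrite scalerA mulNr scaleNr.
- by move=> i j [].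
- by [].
case=> // -[|j] _; first by right; exists 0%N.
by left; rewrite heis_ccP (xhalf j).1 scaler0 heisE linear0.
Qed.

Lemma nprod_dpsiT_psiF K n : bounded K x ->
  nprod true (fder (psi true)) (psi false) (n.+1%:Z + 1) x =
  \sum_(j < K) (n.+1 + j).+1%:R *: fC C (false, j : nat) (fD C (false, n.+1 +
    j)%N x).
Proof.
move=> xK; rewrite /nprod expr1 scaleN1r fsbig1 ?add0r; last first.
  by case=> // j _; rewrite idxN psi_false0 /fder psiE linear0 scaler0.
have idxP j : n.+1%:Z + 1 - 1 - (n.+1 + j).+1%:Z = Negz j by rewrite NegzE; lia.
have fderP j : fder (psi true) (Posz j.+1) x = - (j.+1%:R *: fD C (false, j) x).
  by rewrite /fder (_ : Posz j.+1 - 1 = Posz j) ?psiE ?scaleNr //; lia.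
rewrite (@fsum_nat _ _ (fun j => Posz (n.+1 + j).+1) K).
- rewrite -sumrN; apply: eq_bigr => j _.
  by rewrite idxP fderP psiE endoNr endoZr opprK.
- by move=> i j []; lia.
- by [].
case=> // -[|i] _; first by left; rewrite /fder mulr0z !oppr0 scale0r psiE
  linear0.
have [ni|ni] := leqP n.+1 i; last first.
  left; rewrite fderP (_ : _ - _ = Posz (n.+1 - i.+1)); last by lia.
  by rewrite psiE endoNr endoZr -psiE psi_false_fD scaler0 oppr0.
have [iK|Ki] := ltnP (i - n.+1) K; first by right; exists (i - n.+1)%N;
  rewrite ?subnKC.
have Ki' : (K <= i)%N := leq_trans Ki (leq_subr _ _).
by left; rewrite fderP (xK (false, i) Ki').2 scaler0 oppr0 psiE linear0.
Qed.

Lemma nprod_dpsiF_psiT K n : bounded K x ->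
  nprod true (fder (psi false)) (psi true) (n.+1%:Z + 1) x =
  \sum_(j < K) j%:R *: fC C (false, j : nat) (fD C (false, n.+1 + j)%N x).
Proof.
move=> xK; rewrite /nprod expr1 scaleN1r [X in _ - X]fsbig1 ?subr0; last first.
  case=> // -[|j] _; first by rewrite /fder mulr0z !oppr0 scale0r psiE linear0.
  rewrite /fder (_ : Posz j.+1 - 1 = Posz j); last by lia.
  by rewrite psi_false0 scaler0 psiE linear0.
have fderN j y : fder (psi false) (Negz j) y = j.+1%:R *: fC C (false, j.+1) y.
  rewrite /fder NegzE opprK (_ : _ - 1 = Negz j.+1) ?psiE //.
  by rewrite NegzE; lia.
rewrite (@fsum_nat _ _ Negz K).
- transitivity (\sum_(j < K.+1) j%:R *: fC C (false, j : nat) (fD C (false,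
  n.+1 + j)%N x)).
    rewrite big_ord_recl scale0r add0r; apply: eq_bigr => j _.
    by rewrite fderN idxN psiE /= addnS.
  have Kn : (K <= n.+1 + K)%N by lia.
  by rewrite big_ord_recr /= (xK (false, n.+1 + K)%N Kn).2 linear0 scaler0
    addr0.
- by move=> i j [].
- by [].
case=> // j _; have [jK|Kj] := ltnP j K; first by right; exists j.
have Knj : (K <= n.+2 + j)%N := leq_trans Kj (leq_addl _ _).
left; rewrite fderN idxN psiE /= (xK (false, n.+2 + j)%N Knj).2 linear0.
by rewrite scaler0.
Qed.

Let fin a f d n := @locally_finite_mulD C a f d false n.

Lemma nprod_cc_psiE n :
  nprod false (heis w (cc C)) (psi true) (n%:Z + 1) x =
  2 *: cdpsi (fun=> 2^-1) n.+1 x - q.*2.+1%:R *: fD C (false, n) x.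
Proof.
have [K xK] := ex_bounded x; rewrite (nprod_cc_psi _ xK); congr (_ - _).
rewrite /cdpsi (lsum_bounded _ xK); last by apply: fin; right.
rewrite scaler_sumr; apply: eq_bigr => j _.
by rewrite endoZE endoME scalerA mulfV ?scale1r // pnatr_eq0.
Qed.

Lemma nprod_dd_psiE n :
  nprod false (heis w (dd C)) (psi false) (n%:Z + 1) x =
  2 *: psidc (fun k => (n + k).+1%:R) n x.
Proof.
have [K xK] := ex_bounded x; rewrite (nprod_dd_psi _ xK).
rewrite /psidc (lsum_bounded _ xK); last by apply: fin; left.
rewrite scaler_sumr; apply: eq_bigr => j _.
by rewrite endoZE endoME scalerA.
Qed.

Lemma nprod_cc_ddE n :
  nprod false (heis w (cc C)) (heis w (dd C)) (n.+1%:Z + 1) x =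
  2 *: cdc (fun k => (n.+1 + k).+1%:R) n.+1 x
  - (q.*2.+1%:R * (2 * n.+1%:R)) *: bD C (false, n) x.
Proof.
have [K xK] := ex_bounded x; rewrite (nprod_cc_dd _ xK); congr (_ - _).
rewrite /cdc (lsum_bounded _ xK); last by apply: fin; left.
rewrite scaler_sumr; apply: eq_bigr => j _.
by rewrite endoZE endoME scalerA.
Qed.

Lemma nprod_dpsiE n :
  nprod true (fder (psi true)) (psi false) (n.+1%:Z + 1) x
  + nprod true (fder (psi false)) (psi true) (n.+1%:Z + 1) x =
  2 *: psidpsi (fun m => m%:R + (n.+1%:R + 1) / 2) n.+1 x.
Proof.
have [K xK] := ex_bounded x.
rewrite [X in X + _](nprod_dpsiT_psiF _ xK) [X in _ + X](nprod_dpsiF_psiT _ xK).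
rewrite /psidpsi (lsum_bounded _ xK); last by apply: fin; right.
rewrite scaler_sumr -big_split; apply: eq_bigr => j _ /=.
rewrite -scalerDl scalerA; congr (_ *: _).
by rewrite -addn1 !natrD; field.
Qed.

Lemma tau_modesE n : tau_modes cL w (n%:Z + 1) x = sqrtC 2 *: Gder C q n x.
Proof.
rewrite /tau_modes /fadd /fscale nprod_cc_psiE nprod_dd_psiE.
rewrite /fder addrK psi_false0 !scaler0 addr0 psiE.
rewrite -[psi_op true _ x]/(fD C (false, n) x) /Gder !endoDE endoZE.
move: (cdpsi _ _ x) (psidc _ _ x) (fD _ _ x) => y z t.
rewrite [-1 *: _]scalerA half_regroup.
rewrite (_ : -1 * _ - _ = n%:R - q%:R + 2^-1) //.
by rewrite double1_natr intrD; field.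
Qed.

Lemma omega_modesE n : omega_modes cL w (n.+1%:Z + 1) x = Lder C q n.+1 x.
Proof.
rewrite /omega_modes /fadd /fscale nprod_cc_ddE -addrA -scalerDr nprod_dpsiE.
rewrite /fder addrK heis_ccP heis_ddP (xhalf n).1 !scaler0 addr0.
rewrite /Lder !endoDE endoZE.
move: (cdc _ _ x) (psidpsi _ _ x) (bD _ _ x) => y z t.
rewrite [LHS]addrAC [X in _ + X]scalerA [X in _ + X]scalerA half_regroup.
rewrite (_ : _ - _ / 2 = even_shift C q n.+1) //.
by rewrite double1_natr intrD /even_shift -muln2 natrM; field.
Qed.

End OnHalfFock.
End Modes.

(** * The screening operator on the half Fock space *)

Section ScreeningOnHalfFock.
Variable C : numClosedFieldType.
Implicit Types (x : Fock C).

Lemma ps_powE (A : nat -> Fock C -> Fock C) (a : pseries (endo C)) j k x :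
  a 0%N = 0 -> (forall n, A n.+1 =1 a n.+1) -> ps_pow A j k x = (a ^+ j) k x.
Proof.
move=> a0 Aa; elim: j k => [|j IHj] k; first by case: k.
rewrite exprS psM endo_sumE big_ord_recl a0 mul0r add0r.
rewrite -[LHS]/(\sum_(1 <= n < k.+1) A n (ps_pow A j (k - n) x)).
by rewrite big_add1 big_mkord; apply: eq_bigr => i _; rewrite Aa IHj.
Qed.

Lemma ps_expE (A : nat -> Fock C -> Fock C) (a : pseries (endo C)) k x :
  a 0%N = 0 -> (forall n, A n.+1 =1 a n.+1) -> ps_exp A k x = expseries a k x.
Proof.
move=> a0 Aa; rewrite /ps_exp big_mkord endo_sumE.
by apply: eq_bigr => j _; rewrite (ps_powE _ _ _ a0 Aa).
Qed.

Lemma ps_exp_fixed (A : nat -> Fock C -> Fock C) k x :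
  (forall n, A n.+1 x = 0) -> (forall n, A n.+1 0 = 0) ->
  ps_exp A k x = if k == 0%N then x else 0.
Proof.
move=> Ax A0.
have pow j m : ps_pow A j m x = if (j == 0%N) && (m == 0%N) then x else 0.
  elim: j m => //= j IHj m; rewrite big_add1 big1 // => i _.
  by rewrite IHj; case: ifP; rewrite ?Ax ?A0.
rewrite /ps_exp big_mkord big_ord_recl fact0 invr1 scale1r pow.
by rewrite big1 ?addr0 // => i _; rewrite pow scaler0.
Qed.

Variables (cL : C) (q : nat).

(** The exponent of [z] at which a coefficient is taken may be negative. *)
Definition exp_at (u : pseries (endo C)) (z : int) : endo C :=
  if z is Posz k then expseries u k else 0.

(** The annihilation half of the vertex operator of [e^(tc)] involves only
    derivatives with respect to [d(-n)], because [c] is isotropic, so it fixes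
    [x]. The factor [z^(tc(0))] contributes the exponent [- t (2q + 1)]. *)
Lemma YexpE s (t : C) (u : pseries (endo C)) e z x :
  (forall k, bD C (true, k) x = 0) -> u 0%N = 0 ->
  (forall k, u k.+1 = (k.+1%:R^-1 * t) *: bC C (false, k)) ->
  e + t * q.*2.+1%:R = z%:~R ->
  Yexp (wt cL q.*2%:R s) (t *: cc C) e x = exp_at u z x.
Proof.
move=> xd u0 uE ez; set w := wt _ _ _; rewrite /Yexp.
have formE : Defs.form (t *: cc C) w = - (t * q.*2.+1%:R).
  rewrite /Defs.form wt_snd double1_natr /=.
  by rewrite scaler0 mul0r addr0 -[t%:A]/(t * 1) mulr1; field.
rewrite formE.
set cre := fun n y => n%:R^-1 *: _; set ann := fun n y => - n%:R^-1 *: _.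
have creE n : cre n.+1 =1 u n.+1.
  move=> y; rewrite /cre -NegzE heisE uE /=
    -[t%:A]/(t * 1) mulr1 scaler0 scale0r.
  by rewrite addr0 scalerA.
have annE n y : bD C (true, n) y = 0 -> ann n.+1 y = 0.
  move=> yd; rewrite /ann heisE /= yd scaler0 addr0 /Defs.form /= scaler0.
  by rewrite !(mulr0, mul0r, addr0, scale0r, scaler0).
have termE kl : ps_exp cre kl.1 (ps_exp ann kl.2 x) =
    if kl.2 == 0%N then expseries u kl.1 x else 0.
  rewrite (@ps_exp_fixed ann) => [|n|n]; [|by apply: annE|by apply: annE;
    exact: linear0].
  by rewrite (ps_expE _ _ u0 creE); case: ifP; rewrite ?linear0.
under eq_fsbigr do rewrite termE.
have klE k : k%:R - 0%:R + - (t * q.*2.+1%:R) = e <-> Posz k = z.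
  split=> [ke|kz].
    by apply/eqP; rewrite -(eqr_int C) -ez -ke subr0 subrK.
  by rewrite -[RHS](addrK (t * q.*2.+1%:R)) ez -kz subr0.
case: z ez klE => z ez klE; last first.
  by rewrite fsbig1 // => -[k [|l]] //= /klE.
rewrite (@fsum_nat _ _ _ (fun j => (z, j)) 1).
- by rewrite big_ord1.
- by move=> i j [].
- by case=> // _; apply/klE.
by move=> [k [|l]] /= kl; [right; exists 0%N => //;
  move/klE: kl => [->] | left].
Qed.

Local Notation u := (useries C).
Local Notation E := (expseries u).
Local Notation psis := (psiseries C).
Local Notation F := (psis * E).

Lemma bD_true_useries k i : GRing.comm (bD C (true, k)) (u i).
Proof.
case: i => [|i]; first exact: commr0.
by rewrite /GRing.comm /= -scalerAr -scalerAl bD_bC addr0.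
Qed.
Lemma fD_useries i k : GRing.comm (fD C i) (u k).
Proof.
case: k => [|k]; first exact: commr0.
by rewrite /GRing.comm /= -scalerAr -scalerAl bC_fD.
Qed.
Lemma fD_true_psi k i : fD C (true, k) * psis i = - (psis i * fD C (true, k)).
Proof. by rewrite fD_fC addr0. Qed.

Lemma halfFock_E k x : halfFock x -> halfFock (E k x).
Proof.
move=> xh i; split; rewrite -endoME.
  by rewrite (comm_expseries (bD_true_useries i)) endoME (xh i).1 linear0.
by rewrite (comm_expseries (fD_useries (true, i))) endoME (xh i).2 linear0.
Qed.

Lemma halfFock_screening x : halfFock x -> halfFock (screening u psis q x).
Proof.
move=> xh i; split; rewrite -endoME.
  rewrite (@comm_screening _ _ u psis q _ (bD_true_useries i)) ?endoME ?(xh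
    i).1 ?linear0 //.
  by left => k; exact: bD_fC.
rewrite (@comm_screening _ _ u psis q _ (fD_useries (true, i))) ?endoME ?(xh
  i).2 ?linear0 //.
by right => k; exact: fD_true_psi.
Qed.

Lemma halfFock_F k x : halfFock x -> halfFock (F k x).
Proof.
move=> xh; rewrite psM endo_sumE => i; rewrite !linear_sum.
have h m : halfFock ((psis m * E (k - m)%N) x).
  have Eh := halfFock_E (k - m) xh; move=> l; split; rewrite -endoME mulrA.
    by rewrite bD_fC !endoME (Eh l).1 linear0.
  by rewrite fD_true_psi mulNr endoNE !endoME (Eh l).2 linear0 oppr0.
by split; apply: big1 => m _; have [] := h m i.
Qed.

Definition F_at (z : int) : endo C := if z is Posz k then F k else 0.

(** The mode [a_j] multiplies by the coefficient of [z^(-j-1)] in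
    [z^(-(q+1/2)) psi(z) E(z)]. *)
Lemma a_modeE s j z x : halfFock x -> q%:R - 2^-1 - j = z%:~R ->
  a_mode (wt cL q.*2%:R s) j x = F_at z x.
Proof.
move=> xh jz.
have YE n : Yexp (wt cL q.*2%:R s) ((1 / 2) *: cc C) (n%:~R - j) x
    = exp_at u (n + 1 + z) x.
  apply: YexpE => //; first by move=> k; have [] := xh k.
    move=> k; rewrite /useries mul1r; congr (_ *: _).
    by rewrite -muln2 natrM invfM mulrC.
  by rewrite double1_natr !intrD -jz; field.
rewrite /a_mode; under eq_fsbigr do rewrite YE.
have Pos0 n : psi false (Posz n) (exp_at u (Posz n + 1 + z) x) = 0.
  rewrite psiE; case: (_ + _) => [k|k] /=; last exact: linear0.
  by have [] := halfFock_E k xh n.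
case: z {jz YE} Pos0 => Z Pos0; last first.
  rewrite fsbig1 // => -[n|n] _ //.
  by rewrite (_ : _ + _ = Negz (n + Z)) ?psiE ?linear0 //; rewrite !NegzE; lia.
rewrite (@fsum_nat _ _ _ Negz Z.+1) //.
- rewrite -[F_at Z]/(F Z) psM endo_sumE; apply: eq_bigr => i _.
  rewrite psiE (_ : _ + _ = Posz (Z - i)) //.
  by have := ltn_ord i; rewrite NegzE; lia.
- by move=> i k [].
case=> n _; first by left.
have [nZ|Zn] := ltnP n Z.+1; first by right; exists n.
left; rewrite (_ : _ + _ = Negz (n - Z).-1) ?psiE ?linear0 //.
by rewrite !NegzE; lia.
Qed.

Lemma StwE s x : halfFock x ->
  Stw cL q.*2%:R s x =
  \sum_(i < q) (i%:R + 2^-1)^-1 *: (F (q + i)%N * F (q - i.+1)%N) x.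
Proof.
move=> xh; rewrite /Stw.
have first_mode (i : nat) : a_mode (wt cL q.*2%:R s) (i%:R + 1 / 2) x
    = F_at (Posz q - Posz i.+1) x.
  by apply: a_modeE => //; rewrite intrB -!pmulrn -(addn1 i) natrD; field.
have second_mode (i : nat) y : halfFock y ->
    a_mode (wt cL q.*2%:R (s + 1 / 2)) (- i%:R - 1 / 2) y = F (q + i)%N y.
  move=> yh; rewrite -[F _]/(F_at (Posz (q + i))); apply: a_modeE => //.
  by rewrite -pmulrn natrD; field.
rewrite (@fsum_nat _ _ _ id q) //.
  apply: eq_bigr => i _; rewrite first_mode.
  have -> : Posz q - Posz i.+1 = Posz (q - i.+1) by have := ltn_ord i; lia.
  by rewrite second_mode ?mul1r //; exact: halfFock_F.
move=> i _; have [iq|qi] := ltnP i q; first by right; exists i.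
left; rewrite first_mode (_ : _ - _ = Negz (i - q)); last by rewrite NegzE; lia.
rewrite second_mode ?linear0 ?scaler0 //.
by move=> k; rewrite !linear0.
Qed.

Lemma ec0E s x : halfFock x ->
  ec0 cL q.*2%:R s x = expseries (u + u) q.*2 x.
Proof.
move=> xh; rewrite /ec0 -[cc C]scale1r.
rewrite -[expseries (u + u) q.*2]/(exp_at (u + u) (Posz q.*2)); apply: YexpE.
- by move=> k; have [] := xh k.
- by rewrite psD addr0.
- move=> k; rewrite psD /useries -scalerDl; congr (_ *: _).
  rewrite mulr1 -muln2 natrM; field; rewrite ?pnatr_eq0 //.
  by rewrite addrC natr1 pnatr_eq0.
- by rewrite double1_natr -pmulrn -muln2 natrM; ring.
Qed.

Lemma GtwE s x : halfFock x -> Gtw cL q.*2%:R s x = screening u psis q x.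
Proof.
move=> xh; rewrite /Gtw ec0E // StwE // /screening endoDE endoNE; congr (_ - _).
rewrite endo_sumE; apply: eq_bigr => i _.
by rewrite endoZE.
Qed.

Lemma halfFock_vac : halfFock (vac : Fock C).
Proof. by move=> k; rewrite bD_vac fD_vac. Qed.

Lemma Gtw_powE s n :
  Gtw_pow cL q.*2%:R s n vac = (screening u psis q ^+ n) vac
  /\ halfFock ((screening u psis q ^+ n) vac).
Proof.
elim: n => [|n [IHn hn]]; first by split; last exact: halfFock_vac.
rewrite exprS endoME; split; last exact: halfFock_screening.
by rewrite -[LHS]/(Gtw cL _ (s + n%:R) (Gtw_pow cL _ s n vac)) IHn GtwE.
Qed.

Lemma killed_screeningX (D : endo C) n :
  D * screening u psis q = screening u psis q * D -> D vac = 0 ->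
  D ((screening u psis q ^+ n) vac) = 0.
Proof.
move=> /commrX Dg D0; rewrite -endoME (Dg n) endoME D0; exact: linear0.
Qed.

Lemma lsum_vac T : locally_finite T -> lsum T (vac : Fock C) = 0.
Proof.
move=> Tfin; rewrite (@lsum_bounded _ _ 0) ?big_ord0 //.
by move=> i _; rewrite bD_vac fD_vac.
Qed.

Lemma Gder_vac n : Gder C q n vac = 0.
Proof.
rewrite /Gder !endoDE endoZE fD_vac scaler0 !lsum_vac ?addr0 //;
  apply: (@locally_finite_mulD _ _ _ _ false); by [left|right].
Qed.
Lemma Lder_vac n : Lder C q n vac = 0.
Proof.
rewrite /Lder !endoDE endoZE bD_vac scaler0 !lsum_vac ?addr0 //;
  apply: (@locally_finite_mulD _ _ _ _ false); by [left|right].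
Qed.
End ScreeningOnHalfFock.

(** * A character detecting nonvanishing *)

Section Character.
Variable C : numClosedFieldType.

(** Monomials in [c(-1)] alone. *)
Definition pure (b : monomial) : bool :=
  `[< b.2 = fset0 /\ forall j, j != (false, 0%N) -> b.1 j = 0%N >].

(** The character [c(-1) |-> 1], other generators [|-> 0], as an endomorphism
    with values in the line of the vacuum. *)
Definition chi := locked_with gen_key
  (ext (fun b => if pure b then vac else 0) : endo C).

Lemma chi_basis b : chi (basis C b) = if pure b then vac else 0.
Proof. by rewrite /chi unlock -basisE [LHS]linext_ket. Qed.

Lemma chi_vac : chi vac = vac.
Proof.
have vac_pure : pure (mset0, fset0)%fset by apply/asboolP; split=> // j _;
  exact: mset0E.
by rewrite {1}/vac basisE chi_basis vac_pure.
Qed.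

Lemma chi_bC k : chi * bC C (false, k) = if k == 0%N then chi else 0.
Proof.
apply: endo_basis => b; rewrite endoME bC_basis chi_basis.
case: eqP => [->|/eqP k0].
  rewrite chi_basis; congr (if _ then _ else _); apply: asbool_equiv_eq.
  split=> -[b2 b1]; split=> // j j0; have := b1 j j0;
    by rewrite mset1DE (negPf j0).
case: ifP => // /asboolP[_ /(_ (false, k))]; rewrite mset1DE eqxx.
by case: k k0 => // k _ /(_ isT).
Qed.

Lemma chi_fC k : chi * fC C (false, k) = 0.
Proof.
apply: endo_basis => b; rewrite endoME fC_basis; case: ifP => _;
  first exact: linear0.
rewrite endoZr chi_basis; case: ifP => [/asboolP[/= b2 _]|_];
  last exact: scaler0.
by have := fset1U1 (false, k) b.2; rewrite b2.
Qed.
End Character.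

(** * Singular vectors *)

Section SingularVectors.
Variable C : numClosedFieldType.
Variables (cL cLa : C) (q : nat) (r : C) (n : nat).
Local Notation g := (screening (useries C) (psiseries C) q).
Local Notation uv := (u_vec cL q.*2%:R r n).

Lemma u_vecE : uv = (g ^+ n) vac.
Proof. by have [] := Gtw_powE cL q (r - n%:R) n. Qed.

Lemma halfFock_u : halfFock uv.
Proof. by rewrite u_vecE; have [] := Gtw_powE cL q (r - n%:R) n. Qed.

Lemma Gder_u m : Gder C q m uv = 0.
Proof.
rewrite u_vecE; apply: killed_screeningX; last exact: Gder_vac.
apply: (odd_der_screening _ _ _ _ (GderP C q m)) => //.
- exact: useries_comm.
- exact: useries_psi.
- exact: psiseries_anti.
Qed.

Lemma Lder_u m : Lder C q m.+1 uv = 0.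
Proof.
rewrite u_vecE; apply: killed_screeningX; last exact: Lder_vac.
apply: (@even_der_screening _ _ _ _ _ _ _ _ _ _
          (Gder C q 0) (Gder C q m) m) => //.
- exact: useries_comm.
- exact: useries_psi.
- exact: psiseries_anti.
- have := GderP C q 0; rewrite sub0r addrC; exact.
- exact: GderP.
- exact: LderP.
Qed.

Lemma u_vec_neq0 : uv <> 0.
Proof.
have chig : chi C * g = ((2 * 2^-1) ^+ q.*2 / q.*2`!%:R) *: chi C.
  apply: screening_character.
  - by [].
  - exact: useries_comm.
  - case=> [|k]; first by rewrite mulr0.
    rewrite /= -scalerAr chi_bC; case: k => [|k] //=.
    by rewrite scaler0.
  - exact: chi_fC.
have chign k : chi C * g ^+ k = (q.*2`!%:R^-1) ^+ k *: chi C.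
  elim: k => [|k IHk]; first by rewrite mulr1 scale1r.
  rewrite exprS mulrA chig mulfV ?pnatr_eq0 // expr1n mul1r -scalerAl IHk.
  by rewrite scalerA -exprS.
move=> u0; have := chign n => /(congr1 (fun f : endo C => f vac)).
rewrite endoME -u_vecE u0 linear0 endoZE chi_vac => /esym/eqP.
rewrite scaler_eq0 expf_eq0 invr_eq0 pnatr_eq0 -[_ == 0%N]negbK -lt0n fact_gt0.
by rewrite andbF (negPf (vac_neq0 C)).
Qed.

Lemma u_vec_singular : singular_vector (F_ops cL cLa q.*2%:R r) uv.
Proof.
split; first exact: u_vec_neq0.
case=> // -[|m] // _; rewrite (_ : m.+1%:Z - 1 = m%:Z); last by lia.
have uh := halfFock_u; split.
- by rewrite /= omega_modesE // Lder_u.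
- by rewrite -[LHS]/(- cLa *: heis _ _ _ uv) heis_ccP (uh m).1 !scaler0.
- by rewrite /= tau_modesE // Gder_u scaler0.
- by rewrite -[LHS]/(_ *: psi false (Posz m) uv) psi_false0 ?scaler0.
Qed.
End SingularVectors.

Theorem theorem4p6 (R : realType) (cL cLa : R[i]) (hcLa : cLa <> 0)
    (p : nat) (hp : (0 < p)%N) (hpeven : ~~ odd p) (r : R[i])
    (n : nat) (hn : (0 < n)%N) :
  singular_vector (F_ops cL cLa p%:R r) (u_vec cL p%:R r n) /\
  forall (V : lmodType R[i]) (X : SH_ops V) (v : V)
         (phi : {linear Fock R[i] -> V}),
    is_Verma cL cLa p%:R r X v ->
    bijective phi -> SH_hom (F_ops cL cLa p%:R r) X phi -> phi vac = v ->
    singular_vector X (phi (u_vec cL p%:R r n)).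
Proof.
have Fsing : singular_vector (F_ops cL cLa p%:R r) (u_vec cL p%:R r n).
  by rewrite -(even_halfK hpeven); exact: u_vec_singular.
split=> // V X v phi _ /bij_inj phi_inj [hL [ha [hG [hPsi _]]]] _.
have [u0 ukill] := Fsing; split=> [phiu0|k k1].
  by apply: u0; apply: phi_inj; rewrite phiu0 linear0.
have [uL ua uG uPsi] := ukill k k1.
by split; rewrite -?hL -?ha -?hG -?hPsi ?uL ?ua ?uG ?uPsi linear0.
Qed.
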